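(* Let $d\ge2$ and $1\le r\le d$ be integers. Let $F:\mathbb{R}^d\to\mathbb{R}$ be differentiable, bounded below with $F_*:=\inf_xF(x)>-\infty$, and $L$-smooth for some $L>0$, i.e. $\|\nabla F(x)-\nabla F(y)\|\le L\|x-y\|$ for all $x,y\in\mathbb{R}^d$. Let $\mathbb{L}\in\mathbb{R}^{d\times d}$ be a nonzero symmetric positive semidefinite matrix such that for all $x,y\in\mathbb{R}^d$, $$F(y)-F(x)-\langle\nabla F(x),y-x\rangle\le\tfrac12(y-x)^\top\mathbb{L}(y-x).$$ Let $T\ge1$ be an integer, $\eta>0$, $u\in(0,1)$, $\bar\eta=\eta T^{-u}$, let $\{x_k\}_{k\ge0}$ be generated from $x_0\in\mathbb{R}^d$ by RS-NGD with stepsize $\bar\eta$, and put $\Delta_0:=F(x_0)-F_*$. Then $$\frac1T\sum_{k=0}^{T-1}\mathbb{E}[\|\nabla F(x_k)\|]\le\frac{\Delta_0}{\eta\tau T^{1-u}}+\frac{\eta\,\ell(\mathbb{L})\|\mathbb{L}\|}{2\tau T^u}.$$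
   Context: $\|\cdot\|$ is the Euclidean norm on vectors and the induced operator norm on matrices. Haar matrix: a random $d\times r$ matrix $P$ equal to $\sqrt{d/r}$ times the first $r$ columns of a Haar-distributed random orthogonal matrix in $O(d)$. Thus $UP$ has the same law as $P$ for every $U\in O(d)$, $\mathbb{E}[PP^\top]=I_d$, $P^\top P=\frac dr I_r$, and $\|P^\top x\|>0$ almost surely for each fixed $x\neq0$. RS-NGD (randomized subspace normalized gradient descent): $x_0$ is deterministic, $P_0,P_1,\dots\in\mathbb{R}^{d\times r}$ are i.i.d. Haar matrices, and $x_{k+1}=x_k-\bar\eta G_k$, where $G_k=\frac{P_kP_k^\top\nabla F(x_k)}{\|P_k^\top\nabla F(x_k)\|}$ if $P_k^\top\nabla F(x_k)\neq0$ and $G_k=0$ otherwise. The constant $\tau$ is $$\tau=\sqrt{\frac dr}\,\frac{\Gamma\left(\frac{r+1}{2}\right)\Gamma\left(\frac d2\right)}{\Gamma\left(\frac r2\right)\Gamma\left(\frac{d+1}{2}\right)}.$$ For a nonzero positive semidefinite $S\in\mathbb{R}^{d\times d}$, the effective rank is $r_{\mathrm{eff}}(S)=\operatorname{tr}(S)/\|S\|$, and $$\ell(S)=\frac{d(r-1)+r_{\mathrm{eff}}(S)(d-r)}{r(d-1)}.$$ *)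

(* Defs.v *)
From HB Require Import structures.
From mathcomp Require Import all_boot all_order all_algebra finmap.
From mathcomp Require Import all_classical all_reals all_analysis.
Set Implicit Arguments.
Unset Strict Implicit.
Unset Printing Implicit Defensive.
Import Order.TTheory GRing.Theory Num.Theory.
Import numFieldNormedType.Exports.
Local Open Scope classical_set_scope.
Local Open Scope ring_scope.

(* MathComp-Analysis norms a matrix by the maximum of its entries.  That norm is
   used below only for its topology (differentiability and Borel sets), which is
   the Euclidean one; [enorm] and [opnorm] are the Euclidean norm and the
   operator norm it induces. *)

Definition dotp {R : realType} {d : nat} (x y : 'cV[R]_d) : R :=
  (x^T *m y) ord0 ord0.

Definition enorm {R : realType} {d : nat} (x : 'cV[R]_d) : R :=
  Num.sqrt (dotp x x).

Definition opnorm {R : realType} {m n : nat} (A : 'M[R]_(m, n)) : R :=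
  sup [set enorm (A *m x) | x in [set x : 'cV[R]_n | enorm x <= 1]].

Definition psd {R : realType} {d : nat} (S : 'M[R]_d) : Prop :=
  S^T = S /\ forall x : 'cV[R]_d, 0 <= dotp x (S *m x).

Definition reff {R : realType} {d : nat} (S : 'M[R]_d) : R := \tr S / opnorm S.

Definition ell {R : realType} {d : nat} (r : nat) (S : 'M[R]_d) : R :=
  (d%:R * (r%:R - 1) + reff S * (d%:R - r%:R)) / (r%:R * (d%:R - 1)).

(* Partial derivatives; this is the gradient when F is differentiable at x. *)
Definition gradient {R : realType} {d : nat} (F : 'cV[R]_d -> R)
    (x : 'cV[R]_d) : 'cV[R]_d :=
  \col_i 'D_(delta_mx i ord0) F x.

Definition lsmooth {R : realType} {d : nat} (F : 'cV[R]_d -> R) (L : R) : Prop :=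
  forall x y, enorm (gradient F x - gradient F y) <= L * enorm (x - y).

Definition Gamma {R : realType} (x : R) : R :=
  \int[lebesgue_measure]_(t in `]0, +oo[) (t `^ (x - 1) * expR (- t)).

Definition tau (R : realType) (d r : nat) : R :=
  Num.sqrt (d%:R / r%:R) *
  (Gamma ((r%:R + 1) / 2) * Gamma (d%:R / 2)) /
  (Gamma (r%:R / 2) * Gamma ((d%:R + 1) / 2)).

(* The matrices with their Borel sigma-algebra. *)
Definition mxBorel (R : realType) (m n : nat) :=
  g_sigma_algebraType (@open 'M[R]_(m, n)).

Definition orthogonal_group (R : realType) (d : nat) : set 'M[R]_d :=
  [set U | U^T *m U = 1%:M].

(* The Haar distribution of O(d), as a probability measure on all matrices that
   is carried by O(d) and invariant under left translation. *)
Definition haar {R : realType} {d : nat}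
    (mu : probability (mxBorel R d d) R) : Prop :=
  mu (@orthogonal_group R d) = 1%E /\
  forall U : 'M[R]_d, orthogonal_group U ->
  forall B : set 'M[R]_d, measurable (B : set (mxBorel R d d)) ->
    mu [set Q : 'M[R]_d | B (U *m Q)] = mu B.

Definition scaled_cols {R : realType} {d r : nat} (hrd : (r <= d)%N)
    (Q : 'M[R]_d) : 'M[R]_(d, r) :=
  Num.sqrt (d%:R / r%:R) *: colsub (widen_ord hrd) Q.

(* X has the law of [scaled_cols] applied to a Haar-distributed orthogonal
   matrix. *)
Definition haar_matrix {disp : measure_display} {Omega : measurableType disp}
    {R : realType} {Pr : probability Omega R} {d r : nat} (hrd : (r <= d)%N)
    (X : {RV Pr >-> mxBorel R d r}) : Prop :=
  exists2 mu : probability (mxBorel R d d) R, haar mu &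
    forall B : set 'M[R]_(d, r), measurable (B : set (mxBorel R d r)) ->
      distribution Pr X B = mu [set Q : 'M[R]_d | B (scaled_cols hrd Q)].

Definition mutually_independent {disp disp' : measure_display}
    {Omega : measurableType disp} {S : measurableType disp'}
    {R : realType} {Pr : probability Omega R}
    (X : nat -> {RV Pr >-> S}) : Prop :=
  forall (J : {fset nat}) (B : nat -> set S),
    (forall i, i \in J -> measurable (B i)) ->
    Pr (\bigcap_(i in [set` J]) (X i @^-1` B i)) =
    (\prod_(i <- J) Pr (X i @^-1` B i))%E.

Definition rsngd_dir {R : realType} {d r : nat} (P : 'M[R]_(d, r))
    (g : 'cV[R]_d) : 'cV[R]_d :=
  if P^T *m g == 0 then 0 else (enorm (P^T *m g))^-1 *: (P *m P^T *m g).

Fixpoint rsngd {R : realType} {d r : nat} (F : 'cV[R]_d -> R) (step : R)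
    (x0 : 'cV[R]_d) (P : nat -> 'M[R]_(d, r)) (k : nat) : 'cV[R]_d :=
  if k is k'.+1 then
    let x := rsngd F step x0 P k' in x - step *: rsngd_dir (P k') (gradient F x)
  else x0.

(* Main.v *)
Require Import Defs.
From HB Require Import structures.
From mathcomp Require Import all_boot all_order all_algebra finmap.
From mathcomp Require Import all_classical all_reals all_analysis.
From mathcomp Require Import measurable_realfun.
From mathcomp Require Import ring lra.
Set Implicit Arguments.
Unset Strict Implicit.
Unset Printing Implicit Defensive.
Import Order.TTheory GRing.Theory Num.Theory.
Import numFieldNormedType.Exports.
Local Open Scope classical_set_scope.
Local Open Scope ring_scope.

(* The upper quadratic bound, taken along the step, gives
   [F x_(k+1) + s |P^T g| <= F x_k + s^2/2 <G, LL G>] with [g] the gradient at [x_k]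
   and [G] the direction.  As [P_k] is independent of [x_k], Fubini reduces the
   theorem to [E|P^T g| = tau |g|] and [E <G, LL G> <= ell(LL) |LL|] for a fixed [g],
   and telescoping concludes.

   Only the left invariance of the Haar law is available, and both expectations are
   computed from it in terms of the random projection [Q = (r/d) P P^T], whose law is
   invariant under conjugation.  Householder reflections suffice: one of them reduces
   to [g = e_i], those flipping or exchanging two coordinates determine the matrix
   [E Q_ij Q_ik / Q_ii], and those close to a coordinate reflection, differentiated,
   give [(d + m) E Q_ii^((m+2)/2) = (r + m) E Q_ii^(m/2)].  The Gamma quotients
   satisfy the same recurrence, and monotonicity in [m] forces equality at [m = 1]. *)

(** * Borel measurability on matrices *)

(** In coordinates where [g = |g| e_i] one has [|P^T g|^2 = (d/r) |g|^2 Q_ii], and [<G, LL G>] is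
    [d/r] times the quadratic form of [LL] at the column [Q e_i], divided by [Q_ii]. So [tau] is a
    moment of order 1/2 of [Q_ii], while the averaged form weights [LL_ii] by [r/d] and shares at
    most [1 - r/d] equally among the other [d - 1] diagonal entries; replacing [LL_ii] by its upper
    bound [|LL|] gives [ell]. The order 1/2 is the obstacle: the recurrence links [m] to [m + 2], so
    the normalisation at [m = 0] fixes the even moments only and leaves the odd ones known up to a
    common factor. The entry [Q_ii] may vanish, which touches both the square root and the quotient;
    idempotence and Cauchy-Schwarz keep all expressions bounded there. The iterates are handled
    through integrals of nonnegative extended reals, with [F] replaced by its gap to the infimum, so
    that Tonelli and the telescoping apply directly. *)

Lemma continuous_mxBorel (R : realType) m n (f : 'M[R]_(m, n) -> R) :
  continuous f -> measurable_fun setT (f : mxBorel R m n -> R).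
Proof.
move=> cf; apply: (measurability _ (RGenOInfty.measurableE R)).
move=> _ [_ [x ->] <-]; rewrite setTI.
apply: sub_sigma_algebra.
by apply: open_comp => // ? _; apply: cf.
Qed.

Lemma measurable_mx_entry (R : realType) m n (i : 'I_m) (j : 'I_n) :
  measurable_fun [set: mxBorel R m n] (fun Q : 'M[R]_(m, n) => Q i j).
Proof. by apply: continuous_mxBorel; exact: coord_continuous. Qed.

(** Rational centres and radii [1/(n+1)] form a countable index type, so an open set becomes a
    countable union of balls; this reduces Borel measurability to a check on entries. *)
Lemma open_rat_ball (R : realType) m n (A : set 'M[R]_(m, n)) : open A ->
  A = \bigcup_(p in [set p : 'M[rat]_(m, n) * nat |
        ball (map_mx ratr p.1 : 'M[R]_(m, n)) p.2.+1%:R^-1 `<=` A])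
      ball (map_mx ratr p.1 : 'M[R]_(m, n)) p.2.+1%:R^-1.
Proof.
move=> oA; apply/seteqP; split=> [Q AQ|Q [p /= + Qp]]; last by apply.
have /nbhs_ballP[e /= e0 QeA] : nbhs Q A by move: oA; rewrite openE; exact.
(* The radius is spent twice, on the rational point near [Q] and on the ball around that point,
   hence half of [e]. *)
have [k ke] : exists k, k.+1%:R^-1 < e / 2 :> R.
  have e20 : 0 < e / 2 by rewrite divr_gt0.
  by exists (Num.truncn (e / 2)^-1); rewrite invf_plt ?posrE// truncnS_gt.
have rat_near (x : R) : exists q : rat, `|ratr q - x| < k.+1%:R^-1.
  have xk : x - k.+1%:R^-1 < x + k.+1%:R^-1.
    by rewrite ltrBlDr -addrA ltrDl addr_gt0 ?invr_gt0.
  have [q] := rat_in_itvoo xk; rewrite in_itv/= => /andP[q1 q2].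
  by exists q; rewrite ltr_norml ltrBlDr ltrBrDr addrC q1 addrC q2.
pose q : 'M[rat]_(m, n) := \matrix_(i, j) projT1 (cid (rat_near (Q i j))).
exists (q, k) => /=.
- move=> Q' ; rewrite mx_norm_ball /ball_/= => qQ'.
  apply: QeA; rewrite mx_norm_ball /ball_/=.
  have qQ : `|map_mx ratr q - Q| < k.+1%:R^-1.
    rewrite [X in X < _]/Num.Def.normr/= mx_normrE; apply/bigmax_ltP.
    split; rewrite ?invr_gt0// => -[i j] _ /=; rewrite !mxE.
    by case: cid.
  rewrite -(subrKA (map_mx ratr q)) (le_lt_trans (ler_normD _ _))//.
  rewrite distrC (splitr e) ltrD//; exact: lt_trans ke.
- rewrite mx_norm_ball /ball_/=.
  rewrite [X in X < _]/Num.Def.normr/= mx_normrE; apply/bigmax_ltP.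
  split; rewrite ?invr_gt0// => -[i j] _ /=; rewrite !mxE.
  by case: cid.
Qed.

(** Balls of the maximum norm are finite intersections of conditions on single entries, so
    measurable entries reach every open set through [open_rat_ball]. *)
Lemma measurable_mx_fun (R : realType) m n d (T : measurableType d)
    (f : T -> mxBorel R m n) :
  (forall i j, measurable_fun setT (fun t => (f t : 'M[R]_(m, n)) i j)) ->
  measurable_fun setT f.
Proof.
move=> mf; apply: (@measurability _ _ T (mxBorel R m n) setT f open) => //.
move=> _ [A oA <-]; rewrite setTI (open_rat_ball oA) preimage_bigcup.
rewrite bigcup_mkcond; apply: countable_bigcupT_measurable => // p.
case: ifPn => [_|_]; last exact: measurable0.
have -> : f @^-1` ball (map_mx ratr p.1 : 'M[R]_(m, n)) p.2.+1%:R^-1 =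
    \bigcap_(i in [set: 'I_m]) \bigcap_(j in [set: 'I_n])
      ((fun t => (f t : 'M[R]_(m, n)) i j) @^-1`
        ball (ratr (p.1 i j) : R) p.2.+1%:R^-1).
  apply/seteqP; split=> [t [_ h] i _ j _|t h]; first by have := h i j; rewrite mxE.
  by split=> [|i j]; [rewrite invr_gt0|rewrite mxE; exact: h].
apply: fin_bigcap_measurable; [exact: finite_finset|move=> i _].
apply: fin_bigcap_measurable; [exact: finite_finset|move=> j _].
rewrite -[X in measurable X]setTI; apply: mf => //.
by apply: open_measurable; exact: ball_open.
Qed.

(** * The Gamma function at half-integers *)

Section gamma.
Context {R : realType}.
Notation mu := (@lebesgue_measure R).
Implicit Types x t : R.

Local Notation dens x t := (t `^ (x - 1) * expR (- t)).

(** Kept in the extended reals: the functional equation and the AM-GM estimate hold there before any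
    finiteness is known, and finiteness at half-integers is deduced from them. *)
Definition eGamma x : \bar R := (\int[mu]_(t in `]0%R, +oo[) (dens x t)%:E)%E.

Lemma eGammaE x : Gamma x = fine (eGamma x). Proof. by []. Qed.

Lemma measurable_gamma_density x (A : set R) :
  measurable_fun A (fun t => dens x t).
Proof.
apply: (@measurable_funS _ _ _ _ setT) => //.
apply: measurable_funM; first exact: measurable_powR.
exact: measurableT_comp.
Qed.

Lemma gamma_density_ge0 x t : 0 <= dens x t.
Proof. by rewrite mulr_ge0 ?powR_ge0 ?expR_ge0. Qed.

Lemma eGamma_ge0 x : (0 <= eGamma x)%E.
Proof. by apply: integral_ge0 => t _; rewrite lee_fin gamma_density_ge0. Qed.

Lemma is_derive_opp_expRN t : is_derive t 1 (fun s : R => - expR (- s)) (expR (- t)).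
Proof. by apply: is_derive_eq; rewrite mulrN1 opprK. Qed.

Lemma powR_cvgn0 (c x : R) : 0 < c -> 0 < x ->
  (c / n.+1%:R) `^ x @[n --> \oo] --> (0 : R).
Proof.
move=> c0 x0; have /cvg_at_rightP := powR_cvg0 x0; apply; split.
  by move=> n; rewrite divr_gt0.
rewrite -[X in _ --> X](mulr0 c); apply: cvgMr.
exact: cvg_harmonic.
Qed.

(** The left side is [(t e^(-t/x))^x], and [e^(t/x)] is at least its second-order Taylor term. The
    resulting bound vanishes at infinity, which removes the upper boundary term of the integration
    by parts. *)
Lemma powR_expRN_le x t : 0 < x -> 0 < t ->
  t `^ x * expR (- t) <= (2 * x ^+ 2 / t) `^ x.
Proof.
move=> x0 t0.
have -> : - t = - (t / x) * x by rewrite mulNr divfK// gt_eqF.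
rewrite expRM -powRM ?expR_ge0 ?(ltW t0)//.
have x2t : 0 <= 2 * x ^+ 2 / t by rewrite divr_ge0 ?mulr_ge0 ?exprn_ge0 ?ler0n ?(ltW x0) ?(ltW t0).
apply: ge0_ler_powR; rewrite ?nnegrE ?(ltW x0)//.
  by rewrite mulr_ge0 ?expR_ge0 ?(ltW t0).
rewrite expRN ler_pdivrMr ?expR_gt0//.
have tx0 : 0 <= t / x by rewrite divr_ge0 ?ltW.
apply: (le_trans _ (ler_wpM2l x2t (expR_ge1Dxn 1 tx0))).
rewrite -subr_ge0 (_ : 2`!%:R = 2)//.
have -> : 2 * x ^+ 2 / t * (1 + (t / x) ^+ 2 / 2) - t = 2 * x ^+ 2 / t.
  by field; apply/andP; split; exact: lt0r_neq0.
by [].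
Qed.

Lemma gamma_density_ibp (x a b : R) : 0 < a -> a < b ->
  (\int[mu]_(t in `[a, b]) (dens (x + 1) t)%:E =
   (a `^ x * expR (- a) - b `^ x * expR (- b))%:E +
   x%:E * \int[mu]_(t in `[a, b]) (dens x t)%:E)%E.
Proof.
move=> a0 ab.
have pos t : t \in `[a, b] -> 0 < t.
  by rewrite in_itv/= => /andP[+ _]; exact: lt_le_trans.
have cd y : {within `[a, b], continuous (fun t => t `^ y)}.
  apply: derivable_within_continuous => t tab.
  by have [] := is_derive1_powR y (pos _ tab).
have cM (f g : R -> R) : {within `[a, b], continuous f} ->
    {within `[a, b], continuous g} -> {within `[a, b], continuous (fun t => f t * g t)}.
  move=> /subspace_continuousP cf /subspace_continuousP cg.
  by apply/subspace_continuousP => t tab; apply: cvgM; [exact: cf|exact: cg].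
have ce : continuous (fun t : R => expR (- t)).
  by move=> t; apply: continuous_comp; [exact: opp_continuous|exact: continuous_expR].
have LR (f : R -> R) : {in `[a, b], forall t, derivable f t 1} -> derivable_oo_LRcontinuous f a b.
  move=> df; split.
  - by move=> t tab; apply: df; exact: subset_itv_oo_cc tab.
  - apply/cvg_at_right_filter/differentiable_continuous/derivable1_diffP/df.
    by rewrite in_itv/= lexx ltW.
  - apply/cvg_at_left_filter/differentiable_continuous/derivable1_diffP/df.
    by rewrite in_itv/= lexx ltW.
have := @integration_by_parts R (fun t => t `^ x) (fun t => - expR (- t))
  (fun t => x * t `^ (x - 1)) (fun t => expR (- t)) a b ab.
rewrite addrK => ->.
- have idens : mu.-integrable `[a, b] (EFin \o (fun t => dens x t)).
    apply: continuous_compact_integrable; first exact: segment_compact.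
    by apply: cM; [exact: cd|exact: continuous_subspaceT].
  have -> : (\int[mu]_(t in `[a, b]) (x * t `^ (x - 1) * - expR (- t))%:E =
      (- x)%:E * \int[mu]_(t in `[a, b]) (dens x t)%:E)%E.
    rewrite -integralZl//; apply: eq_integral => t _.
    by rewrite -EFinM mulrN mulNr mulrA.
  by rewrite EFinN mulNe oppeK; congr (_%:E + _)%E; rewrite !mulrN opprK addrC.
- apply: cM; last exact: cd.
  by apply: continuous_subspaceT => t; exact: cst_continuous.
- apply: LR => t tab.
  by have [] := is_derive1_powR x (pos _ tab).
- move=> t tab; rewrite derive1E.
  by have [_ ->] := is_derive1_powR x (pos _ (subset_itv_oo_cc tab)).
- exact: continuous_subspaceT.
- by apply: LR => t tab; have [] := is_derive_opp_expRN t.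
- by move=> t tab; rewrite derive1E; have [_ ->] := is_derive_opp_expRN t.
Qed.


(** With [n.+2] every interval has distinct endpoints and stays away from 0, as integration by parts
    on it requires. *)
Lemma bigcup_itv_pos : \bigcup_n `[(n.+2%:R)^-1, n.+2%:R : R]%classic = `]0%R, +oo[%classic.
Proof.
apply/seteqP; split=> t /=.
  move=> [n _] /=; rewrite !in_itv/= andbT => /andP[+ _]; apply: lt_le_trans.
  by rewrite invr_gt0.
rewrite in_itv/= andbT => t0.
exists (maxn (Num.truncn t) (Num.truncn t^-1)) => //=.
rewrite in_itv/=; apply/andP; split.
  rewrite invf_ple ?posrE//; apply: ltW; apply: (lt_trans (truncnS_gt _)).
  by rewrite ltr_nat ltnS ltnS leq_maxr.
apply: ltW; apply: (lt_trans (truncnS_gt _)).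
by rewrite ltr_nat ltnS ltnS leq_maxl.
Qed.

Lemma cvg_eGamma x :
  (\int[mu]_(t in `[(n.+2%:R^-1)%R, n.+2%:R%R]) (dens x t)%:E)%E @[n --> \oo] --> eGamma x.
Proof.
rewrite /eGamma -bigcup_itv_pos; apply: ge0_nondecreasing_set_cvg_integral => //.
- move=> m n mn; rewrite subsetEset => t /=; rewrite !in_itv/= => /andP[mt tm].
  rewrite (le_trans _ mt) ?(le_trans tm) ?ler_nat ?ltnS//.
  by rewrite lef_pV2 ?posrE// ler_nat !ltnS.
- by move=> n; apply/measurable_EFinP; exact: measurable_gamma_density.
- by move=> n t _; rewrite lee_fin gamma_density_ge0.
Qed.

(** Integration by parts on the exhausting intervals; both boundary terms tend to 0, the lower one
    because [x > 0] and the upper one by [powR_expRN_le]. *)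
Lemma eGammaS x : 0 < x -> eGamma (x + 1) = (x%:E * eGamma x)%E.
Proof.
move=> x0; apply: (cvg_unique _ (@cvg_eGamma (x + 1))) => //.
have invn (n : nat) : 0 < (n.+2%:R : R)^-1 by rewrite invr_gt0.
have ltn (n : nat) : (n.+2%:R : R)^-1 < n.+2%:R.
  by rewrite (@lt_trans _ _ 1) ?ltr1n// invf_lt1 ?ltr1n.
rewrite /=; under eq_fun => n do rewrite (gamma_density_ibp _ (invn n) (ltn n)).
rewrite -[(x%:E * _)%E]add0e; apply: cvgeD => //.
  apply: cvg_EFin; first exact: nearW.
  rewrite -[X in _ --> X](subr0 0); apply: cvgB.
  - apply: (@squeeze_cvgr _ _ _ _ (fun=> 0) (fun n => (1 / n.+2%:R) `^ x)).
    + apply: nearW => n; rewrite mulr_ge0 ?powR_ge0 ?expR_ge0//= div1r.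
      by rewrite ler_piMr ?powR_ge0// expR_le1 oppr_le0 ltW.
    + exact: cvg_cst.
    + have := powR_cvgn0 ltr01 x0; rewrite -(cvg_shiftS (fun n => (1 / n.+1%:R) `^ x)).
      exact.
  - apply: (@squeeze_cvgr _ _ _ _ (fun=> 0) (fun n => (2 * x ^+ 2 / n.+2%:R) `^ x)).
    + by apply: nearW => n; rewrite mulr_ge0 ?powR_ge0 ?expR_ge0//= powR_expRN_le.
    + exact: cvg_cst.
    + have c0 : 0 < 2 * x ^+ 2 by rewrite mulr_gt0 ?exprn_gt0.
      have := powR_cvgn0 c0 x0.
      rewrite -(cvg_shiftS (fun n => (2 * x ^+ 2 / n.+1%:R) `^ x)).
      exact.
by apply: cvgeZl => //; exact: cvg_eGamma.
Qed.

(** The integrand is the density of the exponential law of rate 1, which has total mass 1 and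
    vanishes on the negative half-line. *)
Lemma eGamma1 : eGamma 1 = 1%E.
Proof.
rewrite /eGamma -(integral_exponential_pdf ltr01).
rewrite [RHS](_ : _ = \int[mu]_(t in `[0%R, +oo[) (exponential_pdf 1 t)%:E)%E.
  rewrite -integral_itv_obnd_cbnd; last first.
    by apply/measurable_EFinP; apply: measurable_funTS; exact: measurable_exponential_pdf.
  apply: eq_integral => t; rewrite inE/= in_itv/= andbT => t0.
  rewrite subrr powRr0 mul1r exponential_pdfE ?ltW//.
  by rewrite mul1r mulN1r.
rewrite [RHS]integral_mkcond; apply: eq_integral => t _; rewrite patchE.
case: ifPn => // t0; rewrite lt0_exponential_pdf//.
move: t0; rewrite notin_setE/= in_itv/= andbT => /negP.
by rewrite -ltNge.
Qed.

(* Weighted AM-GM: [t^(x-1/2) <= (l t^(x-1) + t^x / l) / 2]. *)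
Lemma eGamma_half_le x (l : R) : 0 < l ->
  (eGamma (x + 2^-1) <= (l / 2)%:E * eGamma x + (l^-1 / 2)%:E * eGamma (x + 1))%E.
Proof.
move=> l0; have il0 : 0 < l^-1 by rewrite invr_gt0.
have mE (y : R) : measurable_fun (`]0%R, +oo[%classic : set R) (fun t : R => (dens y t)%:E).
  by apply/measurable_EFinP; exact: measurable_gamma_density.
have dE0 (y t : R) : (`]0%R, +oo[%classic : set R) t -> (0 <= (dens y t)%:E)%E.
  by move=> _; rewrite lee_fin gamma_density_ge0.
rewrite /eGamma -!ge0_integralZl_EFin//; [|exact: dE0|exact: mE|by rewrite divr_ge0// ltW
  |exact: dE0|exact: mE|by rewrite divr_ge0// ltW].
have l20 : 0 <= l / 2 by rewrite divr_ge0// ltW.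
have il20 : 0 <= l^-1 / 2 by rewrite divr_ge0// ltW.
have mkE (c y : R) : measurable_fun (`]0%R, +oo[%classic : set R)
    (fun t : R => (c%:E * (dens y t)%:E)%E).
  by apply: emeasurable_funM => //; exact: measurable_cst.
have kE0 (c y : R) : 0 <= c -> forall t : R, (`]0%R, +oo[%classic : set R) t ->
    (0 <= c%:E * (dens y t)%:E)%E.
  by move=> c0 t _; rewrite -EFinM lee_fin mulr_ge0 ?gamma_density_ge0.
rewrite -ge0_integralD//; [|exact: kE0|exact: mkE|exact: kE0|exact: mkE].
apply: ge0_le_integral => //.
- exact: dE0.
- exact: mE.
- by apply: emeasurable_funD; exact: mkE.
move=> t; rewrite /= in_itv/= andbT => t0.
rewrite -!EFinM -EFinD lee_fin !mulrA -mulrDl ler_wpM2r ?expR_ge0//.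
have -> : x + 2^-1 - 1 = (x - 1) + 2^-1 by rewrite addrAC.
have -> : x + 1 - 1 = (x - 1) + 1 by rewrite addrAC.
move: (x - 1) => y.
have t0' : t != 0 by rewrite gt_eqF.
rewrite !powRD ?t0' ?implybT// powRr1 ?(ltW t0)// powR12_sqrt ?(ltW t0)//.
set p := t `^ y; set s := Num.sqrt t.
have p0 : 0 <= p by exact: powR_ge0.
clearbody p; have -> : t = s ^+ 2 by rewrite sqr_sqrtr ?ltW.
have -> : l / 2 * p + l^-1 / 2 * (p * s ^+ 2) =
    p * s + p * ((l^-1 / 2) * (l - s) ^+ 2).
  by field; exact: lt0r_neq0.
by rewrite lerDl mulr_ge0// mulr_ge0// sqr_ge0.
Qed.

(** Only the value at 1/2 needs an argument: AM-GM bounds the value at 3/2 by those at 1 and 2, and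
    the functional equation carries finiteness back from 3/2 to 1/2. Two consecutive half-integers
    then start the induction. *)
Lemma eGamma_fin_num k : eGamma (k.+1%:R / 2) \is a fin_num.
Proof.
have eG2 : eGamma (1 + 1) = 1%E by rewrite eGammaS// eGamma1 mule1.
have finS x : 0 < x -> eGamma x \is a fin_num -> eGamma (x + 1) \is a fin_num.
  by move=> x0 fx; rewrite eGammaS// fin_numM.
suff [] : eGamma (k.+1%:R / 2) \is a fin_num /\ eGamma (k.+2%:R / 2) \is a fin_num by [].
elim: k => [|k [IH1 IH2]]; last first.
  split=> //; have -> : k.+3%:R / 2 = k.+1%:R / 2 + 1 :> R.
    by rewrite -[k.+3]addn2 natrD mulrDl divff.
  by apply: finS => //; rewrite divr_gt0.
rewrite divff// eGamma1 mul1r; split=> //.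
have : (eGamma (2^-1 + 1) < +oo)%E.
  rewrite addrC (le_lt_trans (@eGamma_half_le 1 1 ltr01))// eG2 eGamma1 !mule1.
  by rewrite -EFinD ltry.
rewrite eGammaS ?invr_gt0// => h; rewrite ge0_fin_numE ?eGamma_ge0// ltNge leye_eq.
apply: contraTN h => /eqP ->.
by rewrite gt0_muley// lte_fin invr_gt0.
Qed.

Lemma Gamma_halfSS k : Gamma (k.+3%:R / 2) = k.+1%:R / 2 * Gamma (k.+1%:R / 2 : R).
Proof.
rewrite !eGammaE -[k.+3]addn2 natrD mulrDl divff// eGammaS ?divr_gt0//.
by rewrite fineM// eGamma_fin_num.
Qed.

(** After the functional equation the AM-GM factor is [l/2 + x/(2l)]; the choice [l = sqrt x]
    minimises it, with value [sqrt x]. *)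
Lemma Gamma_half_le k :
  Gamma (k.+2%:R / 2) <= Num.sqrt (k.+1%:R / 2) * Gamma (k.+1%:R / 2 : R).
Proof.
have x0 : 0 < k.+1%:R / 2 :> R by rewrite divr_gt0.
set x := k.+1%:R / 2 in x0 *.
have l0 : 0 < Num.sqrt x by rewrite sqrtr_gt0.
have -> : k.+2%:R / 2 = x + 2^-1 by rewrite -[k.+2]addn1 natrD mulrDl div1r.
rewrite !eGammaE -lee_fin EFinM !fineK; last 2 first.
- exact: eGamma_fin_num.
- rewrite (_ : x + 2^-1 = k.+2%:R / 2) ?eGamma_fin_num//.
  by rewrite -[k.+2]addn1 natrD mulrDl div1r.
apply: le_trans (eGamma_half_le _ l0) _; rewrite eGammaS// muleA -EFinM.
rewrite -muleDl ?fin_num_adde_defl// -?EFinD; last exact: eGamma_fin_num.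
rewrite (_ : _ + _ = Num.sqrt x)//.
have xs : x = Num.sqrt x ^+ 2 by rewrite sqr_sqrtr ?ltW.
rewrite {3}xs expr2; field; exact: lt0r_neq0.
Qed.

(** Positivity at 1/2 follows from [Gamma 1 = 1] and the upper bound of [Gamma 1] by a multiple of
    [Gamma (1/2)]; the recurrence does the rest. *)
Lemma Gamma_half_gt0 k : 0 < Gamma (k.+1%:R / 2 : R).
Proof.
suff [] : 0 < Gamma (k.+1%:R / 2 : R) /\ 0 < Gamma (k.+2%:R / 2 : R) by [].
have G1 : Gamma (1 : R) = 1 by rewrite eGammaE eGamma1.
elim: k => [|k [IH1 IH2]]; last first.
  by split=> //; rewrite Gamma_halfSS mulr_gt0// divr_gt0.
have h : 0 < Gamma (2 / 2 : R) by rewrite divff// G1.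
split=> //; have := lt_le_trans h (Gamma_half_le 0).
by rewrite pmulr_rgt0// sqrtr_gt0 divr_gt0.
Qed.

End gamma.

(** * Odd moments determined by a two-step recurrence and monotonicity *)

Section gamma_ratio.
Context {R : realType}.
Local Notation g k := (Gamma (k%:R / 2 : R)).

Lemma half_Gamma_sqr_le k : g k.+2 ^+ 2 <= k.+1%:R / 2 * g k.+1 ^+ 2.
Proof.
have g0 k' : 0 <= g k'.+1 by rewrite ltW ?Gamma_half_gt0.
have k0 : 0 <= k.+1%:R / 2 :> R by rewrite divr_ge0.
have : g k.+2 ^+ 2 <= (Num.sqrt (k.+1%:R / 2) * g k.+1) ^+ 2.
  by rewrite ler_pXn2r ?nnegrE ?mulr_ge0 ?sqrtr_ge0 ?g0 ?Gamma_half_le.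
by rewrite exprMn sqr_sqrtr.
Qed.

(** Both quotients share the positive factor [f / (b e q)]; cancelling it turns comparisons of
    consecutive moments into cross products of Gamma values. *)
Let ratio_le (c a p b e q f : R) : 0 < b -> 0 < e -> 0 < q -> 0 < f ->
  (c * (a * f / (b * e)) <= p * f / (b * q) -> c * (a * q) <= p * e) /\
  (p * f / (b * q) <= c * (a * f / (b * e)) -> p * e <= c * (a * q)).
Proof.
move=> b0 e0 q0 f0; have k0 : 0 < f / (b * e * q) by rewrite divr_gt0 ?mulr_gt0.
have -> : a * f / (b * e) = (a * q) * (f / (b * e * q)).
  by field; rewrite !lt0r_neq0.
have -> : p * f / (b * q) = (p * e) * (f / (b * e * q)).
  by field; rewrite !lt0r_neq0.
by rewrite mulrA !ler_pM2r.
Qed.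

(* Wielandt's squeezing argument: [W n.*2.+1] lies between its even neighbours,
   whose ratio tends to [1]. *)
Let half_moment_unique (g W : nat -> R) (d r : nat) :
  (forall k, (0 < k)%N -> 0 < g k) ->
  (forall k, (0 < k)%N -> g k.+2 = k%:R / 2 * g k) ->
  (forall k, (0 < k)%N -> g k.+1 ^+ 2 <= k%:R / 2 * g k ^+ 2) ->
  (0 < r)%N -> (r <= d)%N -> W 0%N = 1 ->
  (forall m, W m.+1 <= W m) ->
  (forall m, (d%:R + m%:R) * W m.+2 = (r%:R + m%:R) * W m) ->
  W 1%N = (g r.+1 * g d) / (g r * g d.+1).
Proof.
move=> gp gSS gS r0 rd W0 Wdec Wrec.
have d0 : (0 < d)%N by exact: leq_trans rd.
(* For [g k = Gamma (k/2)] and [r < d] this is the moment of order [m/2] of the Beta law with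
   parameters [r/2] and [(d - r)/2]. *)
pose V m := g (r + m)%N * g d / (g r * g (d + m)%N).
have Vp m : 0 < V m.
  by rewrite /V divr_gt0 ?mulr_gt0 ?gp// addn_gt0 ?r0 ?d0.
have natp k : (0 < k)%N -> 0 < k%:R :> R by rewrite ltr0n.
have Vrec m : V m.+2 = (r%:R + m%:R) / (d%:R + m%:R) * V m.
  rewrite /V !addnS !gSS ?addn_gt0 ?r0 ?d0// !natrD; field.
  rewrite -!natrD !lt0r_neq0 ?gp ?natp ?addn_gt0 ?r0 ?d0//.
have Wrec' m : W m.+2 = (r%:R + m%:R) / (d%:R + m%:R) * W m.
  have := Wrec m; have : d%:R + m%:R != 0 :> R.
    by rewrite -natrD lt0r_neq0// natp// addn_gt0 d0.
  by move=> dm0 h; apply: (mulfI dm0); rewrite h; field.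
(* The recurrence ties [W] to [V] at even indices and leaves this one unknown factor at the odd
   ones; it remains to show that it is 1. *)
pose c := W 1%N / V 1%N.
have Weven n : W n.*2 = V n.*2.
  elim: n => [|n IH]; last by rewrite doubleS Wrec' Vrec IH.
  rewrite W0 /V !addn0; field; rewrite !lt0r_neq0 ?gp//.
have Wodd n : W n.*2.+1 = c * V n.*2.+1.
  elim: n => [|n IH]; first by rewrite /c divfK// lt0r_neq0.
  by rewrite doubleS Wrec' Vrec IH mulrCA.
have c0 : 0 < c.
  have := Wdec 1%N; rewrite (Weven 1%N) => h.
  by rewrite /c divr_gt0// (lt_le_trans _ h).
have arch (a b : R) : (forall n, a * n.*2%:R <= b) -> a <= 0.
  move=> h; rewrite leNgt; apply/negP => a0.
  have := h (Num.truncn (b / a)).+1.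
  apply/negP; rewrite -ltNge -ltr_pdivrMl// mulrC.
  apply: (lt_le_trans (truncnS_gt _)).
  by rewrite ler_nat -addnn leq_addr.
(* The recurrence and the squared bound at [k.+1] give [g k.+1 / g k >= k / sqrt (2 (k + 1))], and
   the squared bound at [l] gives [g l.+1 / g l <= sqrt (l / 2)]. Everything is compared after
   squaring, ending with [(k + 1) l <= (l + 1)^2]. *)
have key (x y : R) k l : 0 <= x -> 0 <= y -> (0 < k <= l)%N ->
    x * (g k.+1 * g l) <= y * (g k * g l.+1) -> x * k%:R <= y * (l%:R + 1).
  move=> x0 y0 /andP[k0 kl] h; have l0 : (0 < l)%N by exact: leq_trans kl.
  have sq u v : 0 <= u -> 0 <= v -> (u <= v :> R) = (u ^+ 2 <= v ^+ 2).
    by move=> u0 v0; rewrite ler_pXn2r ?nnegrE.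
  have [ga ga' gb gb'] := And4 (gp _ k0) (gp k.+1 isT) (gp _ l0) (gp l.+1 isT).
  have hk := gS k.+1 isT; rewrite gSS// in hk; have hl := gS _ l0.
  rewrite sq in h; last 2 first.
  - by do 2 apply: mulr_ge0 => //; exact: ltW.
  - by do 2 apply: mulr_ge0 => //; exact: ltW.
  rewrite sq; last 2 first.
  - exact: mulr_ge0.
  - by apply: mulr_ge0 => //; exact: addr_ge0.
  have kl' : k%:R <= l%:R :> R by rewrite ler_nat.
  have k0' : 0 < k%:R :> R by exact: natp.
  move: hk hl h.
  move: (g k) (g k.+1) (g l) (g l.+1) ga ga' gb gb' => a a' b b' ga ga' gb gb'.
  rewrite -(natr1 k) !exprMn => hk hl h.
  set K := k%:R in kl' k0' hk *; set L := l%:R in kl' hl *.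
  have ab : 0 < a ^+ 2 * b ^+ 2 by rewrite mulr_gt0 ?exprn_gt0.
  have h1 : x ^+ 2 * K ^+ 2 * (a ^+ 2 * b ^+ 2) <= 2 * (K + 1) * (x ^+ 2 * (a' ^+ 2 * b ^+ 2)).
    have : 0 <= 4 * (x ^+ 2 * b ^+ 2) * ((K + 1) / 2 * a' ^+ 2 - (K / 2) ^+ 2 * a ^+ 2).
      apply: mulr_ge0; last by rewrite subr_ge0 !exprMn.
      by apply: mulr_ge0 => //; rewrite mulr_ge0 ?exprn_ge0// ltW.
    move=> h0; rewrite -subr_ge0; apply: (le_trans h0).
    by rewrite le_eqVlt; apply/orP; left; apply/eqP; field.
  have h2 : 2 * (K + 1) * (x ^+ 2 * (a' ^+ 2 * b ^+ 2)) <=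
      2 * (K + 1) * (y ^+ 2 * (a ^+ 2 * b' ^+ 2)).
    by rewrite ler_wpM2l// mulr_ge0// addr_ge0// ltW.
  have h3 : 2 * (K + 1) * (y ^+ 2 * (a ^+ 2 * b' ^+ 2)) <=
      2 * (K + 1) * (y ^+ 2 * (a ^+ 2 * (L / 2 * b ^+ 2))).
    rewrite ler_wpM2l ?mulr_ge0 ?addr_ge0 ?(ltW k0')//.
    by rewrite ler_wpM2l ?exprn_ge0// ler_wpM2l ?exprn_ge0// ltW.
  have h4 : x ^+ 2 * K ^+ 2 <= y ^+ 2 * ((K + 1) * L).
    rewrite -(ler_pM2r ab); apply: (le_trans h1); apply: (le_trans h2).
    by apply: (le_trans h3); rewrite le_eqVlt; apply/orP; left; apply/eqP; field.
  apply: (le_trans h4); rewrite ler_wpM2l ?exprn_ge0// expr2.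
  by apply: ler_pM; lra.
suff c1 : c = 1 by have := Wodd 0%N; rewrite c1 mul1r => ->; rewrite /V !addn1.
(* Comparing indices [2n] and [2n + 1] gives [c (r + 2n) <= d + 2n + 1], so [(c - 1) 2n] is bounded
   in [n] and [c <= 1]; indices [2n + 1] and [2n + 2] give the converse. *)
apply/eqP; rewrite eq_le; apply/andP; split.
- rewrite -subr_le0; apply: (arch _ (d%:R + 1 - c * r%:R)) => n.
  have : c * (r + n.*2)%:R <= 1 * ((d + n.*2)%:R + 1).
    apply: key; rewrite ?(ltW c0) ?addn_gt0 ?r0 ?leq_add2r//.
    have := Wdec n.*2; rewrite Wodd Weven /V !addnS mul1r.
    by case: (ratio_le c (g (r + n.*2).+1) (g (r + n.*2)) (gp _ r0) (gp (d + n.*2).+1 isT)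
      (gp _ (ltn_addr n.*2 d0)) (gp _ d0)) => h _; exact: h.
  rewrite !natrD; lra.
- rewrite -subr_ge0 -oppr_le0; apply: (arch _ (c * (d%:R + 2) - r%:R - 1)) => n.
  have : 1 * (r + n.*2.+1)%:R <= c * ((d + n.*2.+1)%:R + 1).
    apply: key; rewrite ?(ltW c0) ?addn_gt0 ?r0 ?leq_add2r//.
    have := Wdec n.*2.+1; rewrite Wodd -doubleS Weven /V doubleS !addnS mul1r.
    by case: (ratio_le c (g (r + n.*2).+1) (g (r + n.*2).+2) (gp _ r0) (gp (d + n.*2).+1 isT)
      (gp (d + n.*2).+2 isT) (gp _ d0)) => _ h; exact: h.
  rewrite !natrD -(natr1 n.*2); lra.
Qed.

Lemma half_moment_Gamma (d r : nat) (W : nat -> R) :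
  (0 < r)%N -> (r <= d)%N -> W 0%N = 1 ->
  (forall m, W m.+1 <= W m) ->
  (forall m, (d%:R + m%:R) * W m.+2 = (r%:R + m%:R) * W m) ->
  W 1%N = (g r.+1 * g d) / (g r * g d.+1).
Proof.
apply: (half_moment_unique (g := fun k => g k)) => -[]// k _.
- exact: Gamma_half_gt0.
- exact: Gamma_halfSS.
- exact: half_Gamma_sqr_le.
Qed.

End gamma_ratio.

(** * Euclidean geometry and reflections *)

Section dotp.
Context {R : realType} {d : nat}.
Implicit Types (x y : 'cV[R]_d) (A : 'M[R]_d).

Lemma dotpE x y : dotp x y = \sum_i x i ord0 * y i ord0.
Proof. by rewrite /dotp mxE; apply: eq_bigr => i _; rewrite mxE. Qed.

Lemma mul_trmx_dotp x y : x^T *m y = (dotp x y)%:M.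
Proof. exact: mx11_scalar. Qed.

Lemma dotpC x y : dotp x y = dotp y x.
Proof. by rewrite !dotpE; apply: eq_bigr => i _; rewrite mulrC. Qed.

Lemma dotpDr x y z : dotp x (y + z) = dotp x y + dotp x z.
Proof. by rewrite /dotp mulmxDr mxE. Qed.

Lemma dotpZr a x y : dotp x (a *: y) = a * dotp x y.
Proof. by rewrite /dotp -scalemxAr mxE. Qed.

Lemma dotpNr x y : dotp x (- y) = - dotp x y.
Proof. by rewrite -scaleN1r dotpZr mulN1r. Qed.

Lemma dotpBr x y z : dotp x (y - z) = dotp x y - dotp x z.
Proof. by rewrite dotpDr dotpNr. Qed.

Lemma dotpDl x y z : dotp (y + z) x = dotp y x + dotp z x.
Proof. by rewrite !(dotpC _ x) dotpDr. Qed.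

Lemma dotpBl x y z : dotp (y - z) x = dotp y x - dotp z x.
Proof. by rewrite !(dotpC _ x) dotpBr. Qed.

Lemma dotpZl a x y : dotp (a *: x) y = a * dotp x y.
Proof. by rewrite !(dotpC _ y) dotpZr. Qed.

Lemma dotp_ge0 x : 0 <= dotp x x.
Proof. by rewrite dotpE sumr_ge0// => i _; rewrite -expr2 sqr_ge0. Qed.

Lemma dotp_eq0 x : (dotp x x == 0) = (x == 0).
Proof.
apply/eqP/eqP => [|->]; last by rewrite /dotp mulmx0 mxE.
rewrite dotpE => /eqP; rewrite psumr_eq0 => [/allP h|i _]; last by rewrite -expr2 sqr_ge0.
apply/matrixP => i j; rewrite ord1 mxE.
by have := h i (mem_index_enum _); rewrite mulf_eq0 orbb => /eqP.
Qed.

Lemma enorm_ge0 x : 0 <= enorm x. Proof. exact: sqrtr_ge0. Qed.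

Lemma sqr_enorm x : enorm x ^+ 2 = dotp x x.
Proof. by rewrite sqr_sqrtr ?dotp_ge0. Qed.

Lemma enorm_eq0 x : (enorm x == 0) = (x == 0).
Proof. by rewrite -sqrf_eq0 sqr_enorm dotp_eq0. Qed.

Lemma enormZ a x : enorm (a *: x) = `|a| * enorm x.
Proof. by rewrite /enorm dotpZl dotpZr mulrA -expr2 sqrtrM ?sqr_ge0// sqrtr_sqr. Qed.

Lemma dotp_delta i A j : dotp (delta_mx i ord0) (A *m delta_mx j ord0) = A i j.
Proof.
rewrite /dotp trmx_delta -rowE 2!mxE.
rewrite (bigD1 j)//= big1 ?addr0 => [|k /negPf kj]; rewrite !mxE ?kj ?mulr0// !eqxx.
by rewrite mulr1.
Qed.

Lemma dotp_delta1 i j : dotp (delta_mx i ord0 : 'cV[R]_d) (delta_mx j ord0) = (i == j)%:R.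
Proof. by rewrite -[X in dotp _ X]mul1mx dotp_delta mxE. Qed.

(** The squared norm of [dotp y y *: x - dotp x y *: y] is [dotp y y] times the defect in
    Cauchy-Schwarz. *)
Lemma sqr_dotp_le x y : dotp x y ^+ 2 <= dotp x x * dotp y y.
Proof.
have [->|y0] := eqVneq y 0; first by rewrite /dotp !mulmx0 mxE mulr0 expr0n.
have yp : 0 < dotp y y by rewrite lt_def dotp_eq0 y0 dotp_ge0.
have := dotp_ge0 (dotp y y *: x - dotp x y *: y).
rewrite dotpBr !dotpBl !dotpZr !dotpZl (dotpC y x).
have -> : dotp y y * (dotp y y * dotp x x) - dotp y y * (dotp x y * dotp x y) -
  (dotp x y * (dotp y y * dotp x y) - dotp x y * (dotp x y * dotp y y)) =
  dotp y y * (dotp x x * dotp y y - dotp x y ^+ 2) by ring.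
by rewrite pmulr_rge0// subr_ge0.
Qed.

Lemma dotp_le_enorm x y : dotp x y <= enorm x * enorm y.
Proof.
apply: (le_trans (ler_norm _)).
by rewrite -sqrtr_sqr /enorm -sqrtrM ?dotp_ge0// ler_wsqrtr// sqr_dotp_le.
Qed.

Definition householder (v : 'cV[R]_d) : 'M[R]_d :=
  1%:M - (2 / dotp v v) *: (v *m v^T).

Lemma householderT v : (householder v)^T = householder v.
Proof. by rewrite /householder linearB linearZ /= trmx1 trmx_mul trmxK. Qed.

Lemma householderE v x : householder v *m x = x - (2 * dotp v x / dotp v v) *: v.
Proof.
rewrite /householder mulmxBl mul1mx -scalemxAl -mulmxA mul_trmx_dotp.
by rewrite mul_mx_scalar scalerA mulrAC.
Qed.

Lemma householderK v : v != 0 -> householder v *m householder v = 1%:M.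
Proof.
rewrite -dotp_eq0 => v0; rewrite {2}/householder mulmxBr mulmx1 -scalemxAr mulmxA.
rewrite householderE -mulrA divff// mulr1 scaler_nat mulr2n opprD addNKr.
by rewrite mulNmx scalerN opprK /householder subrK.
Qed.

Lemma householder_orthogonal v : v != 0 -> orthogonal_group (householder v).
Proof. by move=> v0; rewrite /orthogonal_group/= householderT householderK. Qed.

(** For equal norms [2 <x - y, x> = |x - y|^2], so the reflection subtracts exactly [x - y] from
    [x]. *)
Lemma householder_reflect x y : x != y -> dotp x x = dotp y y ->
  householder (x - y) *m x = y.
Proof.
rewrite -subr_eq0 -dotp_eq0 => xy0 xy; rewrite householderE.
have -> : 2 * dotp (x - y) x = dotp (x - y) (x - y).
  by rewrite dotpBl dotpBr !dotpBl xy (dotpC y x); ring.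
by rewrite divff// scale1r opprB addrC subrK.
Qed.

End dotp.

(** An entrywise form of Borel measurability that lets matrix products be treated as finite sums of
    real functions; [mx_measurable_fun] converts between the two. *)
Definition mx_measurable {dT} {T : measurableType dT} {R : realType} {m n}
    (f : T -> 'M[R]_(m, n)) : Prop :=
  forall i j, measurable_fun setT (fun t => f t i j).

Section mx_measurable.
Context {dT} {T : measurableType dT} {R : realType}.

Lemma mx_measurable_cst m n (A : 'M[R]_(m, n)) : mx_measurable (fun _ : T => A).
Proof. by move=> i j; exact: measurable_cst. Qed.

Lemma mx_measurable_tr m n (f : T -> 'M[R]_(m, n)) :
  mx_measurable f -> mx_measurable (fun t => (f t)^T).
Proof. by move=> mf i j; under eq_fun do rewrite mxE; exact: mf. Qed.

Lemma mx_measurable_mul m n p (f : T -> 'M[R]_(m, n)) (g : T -> 'M[R]_(n, p)) :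
  mx_measurable f -> mx_measurable g -> mx_measurable (fun t => f t *m g t).
Proof.
move=> mf mg i j; under eq_fun do rewrite mxE.
by apply: measurable_sum => k; apply: measurable_funM; [exact: mf|exact: mg].
Qed.

Lemma mx_measurable_scale m n (a : T -> R) (f : T -> 'M[R]_(m, n)) :
  measurable_fun setT a -> mx_measurable f -> mx_measurable (fun t => a t *: f t).
Proof.
move=> ma mf i j; under eq_fun do rewrite mxE.
by apply: measurable_funM => //; exact: mf.
Qed.

Lemma mx_measurable_sub m n (f g : T -> 'M[R]_(m, n)) :
  mx_measurable f -> mx_measurable g -> mx_measurable (fun t => f t - g t).
Proof.
move=> mf mg i j; under eq_fun do rewrite !mxE.
by apply: measurable_funB; [exact: mf|exact: mg].
Qed.

Lemma mx_measurable_eq m n (f g : T -> 'M[R]_(m, n)) :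
  mx_measurable f -> mx_measurable g -> measurable [set t | f t = g t].
Proof.
move=> mf mg.
have -> : [set t | f t = g t] = \bigcap_(i in [set: 'I_m]) \bigcap_(j in [set: 'I_n])
    ((fun t => f t i j - g t i j) @^-1` [set 0]).
  apply/seteqP; split=> [t fg i _ j _|t h] /=; first by rewrite fg subrr.
  by apply/matrixP => i j; apply/eqP; rewrite -subr_eq0; apply/eqP; exact: h.
apply: fin_bigcap_measurable; [exact: finite_finset|move=> i _].
apply: fin_bigcap_measurable; [exact: finite_finset|move=> j _].
rewrite -[X in measurable X]setTI; apply: (measurable_funB (mf i j) (mg i j)) => //.
Qed.

Lemma measurable_dotp n (f g : T -> 'cV[R]_n) :
  mx_measurable f -> mx_measurable g -> measurable_fun setT (fun t => dotp (f t) (g t)).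
Proof.
by move=> mf mg; apply: mx_measurable_mul => //; exact: mx_measurable_tr.
Qed.

Lemma measurable_sqrtr (f : T -> R) :
  measurable_fun setT f -> measurable_fun setT (fun t => Num.sqrt (f t)).
Proof.
move=> mf; have -> : (fun t => Num.sqrt (f t)) = Num.sqrt \o f by [].
by apply: measurableT_comp => //; apply: continuous_measurable_fun; exact: sqrt_continuous.
Qed.

Lemma measurable_enorm n (f : T -> 'cV[R]_n) :
  mx_measurable f -> measurable_fun setT (fun t => enorm (f t)).
Proof. by move=> mf; apply: measurable_sqrtr; exact: measurable_dotp. Qed.

End mx_measurable.

(** On nonnegative reals the inverse is the power of exponent -1, also at 0, where both are 0 by
    convention. *)
Lemma measurable_inv_ge0 {dT} {T : measurableType dT} {R : realType} (f : T -> R) :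
  measurable_fun setT f -> (forall t, 0 <= f t) -> measurable_fun setT (fun t => (f t)^-1).
Proof.
move=> mf f0; have -> : (fun t => (f t)^-1) = (fun t => f t `^ (-1)).
  by apply/funext => t; rewrite powR_inv1.
exact: (measurableT_comp (measurable_powR (-1))).
Qed.

Lemma mx_measurable_id {R : realType} m n :
  mx_measurable (fun X : mxBorel R m n => X : 'M[R]_(m, n)).
Proof. by move=> i j; exact: measurable_mx_entry. Qed.

Lemma mx_measurable_fun {R : realType} m n dT (T : measurableType dT)
    (f : T -> mxBorel R m n) :
  measurable_fun setT f <-> mx_measurable (f : T -> 'M[R]_(m, n)).
Proof.
split=> [mf i j|]; last exact: measurable_mx_fun.
exact: (measurableT_comp (measurable_mx_entry i j)).
Qed.

Lemma measurable_mulmxl {R : realType} m n (U : 'M[R]_m) :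
  measurable_fun setT (fun X : mxBorel R m n => (U *m X : mxBorel R m n)).
Proof.
apply: measurable_mx_fun; apply: mx_measurable_mul; last exact: mx_measurable_id.
exact: mx_measurable_cst.
Qed.

(** * Expectations under the Haar law *)

(** The Stiefel manifold scaled by [sqrt (d/r)], on which Haar matrices are concentrated. *)
Definition stiefel (R : realType) (d r : nat) : set 'M[R]_(d, r) :=
  [set X | X^T *m X = (d%:R / r%:R)%:M].

(** What is retained of a Haar matrix once the orthogonal matrix it is cut from is forgotten: its
    support and its left invariance. *)
Definition haar_law {R : realType} {d r : nat} (nu : probability (mxBorel R d r) R) : Prop :=
  nu (@stiefel R d r) = 1%E /\
  forall U : 'M[R]_d, orthogonal_group U ->
  forall B : set 'M[R]_(d, r), measurable (B : set (mxBorel R d r)) ->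
    nu [set X : 'M[R]_(d, r) | B (U *m X)] = nu B.

Lemma measurable_stiefel (R : realType) (d r : nat) :
  measurable (@stiefel R d r : set (mxBorel R d r)).
Proof.
apply: mx_measurable_eq; last exact: mx_measurable_cst.
by apply: mx_measurable_mul; [apply: mx_measurable_tr|]; exact: mx_measurable_id.
Qed.

Lemma stiefel_mul (R : realType) (d r : nat) (U : 'M[R]_d) (X : 'M[R]_(d, r)) :
  orthogonal_group U -> stiefel (U *m X) <-> stiefel X.
Proof.
by rewrite /stiefel/= => UU; rewrite trmx_mul -mulmxA (mulmxA U^T) UU mul1mx.
Qed.

Lemma scaled_cols_mul (R : realType) (d r : nat) (hrd : (r <= d)%N) (U Q : 'M[R]_d) :
  scaled_cols hrd (U *m Q) = U *m scaled_cols hrd Q.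
Proof.
rewrite /scaled_cols -scalemxAr; congr (_ *: _).
by apply/matrixP => i j; rewrite !mxE; apply: eq_bigr => k _; rewrite !mxE.
Qed.

Lemma stiefel_scaled_cols (R : realType) (d r : nat) (hrd : (r <= d)%N) (Q : 'M[R]_d) :
  orthogonal_group Q -> stiefel (scaled_cols hrd Q).
Proof.
rewrite /stiefel/= => QQ; rewrite /scaled_cols; set W := colsub _ Q.
have -> s : (s *: W)^T *m (s *: W) = s ^+ 2 *: (W^T *m W).
  by rewrite [(s *: W)^T]linearZ -scalemxAl -scalemxAr scalerA.
rewrite sqr_sqrtr ?divr_ge0//.
have -> : W^T *m W = 1%:M.
  apply/matrixP => k l.
  transitivity ((Q^T *m Q) (widen_ord hrd k) (widen_ord hrd l)).
    by rewrite !mxE; apply: eq_bigr => m _; rewrite !mxE.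
  by rewrite QQ !mxE.
by rewrite scalemx1.
Qed.

Lemma haar_matrix_law {disp : measure_display} {Omega : measurableType disp}
    {R : realType} {Pr : probability Omega R} {d r : nat} (hrd : (r <= d)%N)
    (X : {RV Pr >-> mxBorel R d r}) :
  haar_matrix hrd X -> haar_law (distribution Pr X).
Proof.
move=> [mu [muO muU] XE].
have mscaled : measurable_fun setT
    (fun Q : mxBorel R d d => (scaled_cols hrd Q : mxBorel R d r)).
  apply: measurable_mx_fun => i j; rewrite /scaled_cols.
  under eq_fun do rewrite !mxE.
  apply: measurable_funM; first exact: measurable_cst.
  exact: measurable_mx_entry.
have mpre (B : set 'M[R]_(d, r)) : measurable (B : set (mxBorel R d r)) ->
    measurable ([set Q : 'M[R]_d | B (scaled_cols hrd Q)] : set (mxBorel R d d)).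
  by move=> mB; rewrite -[X in measurable X]setTI; exact: mscaled.
split.
  apply: (etrans (XE _ (@measurable_stiefel R d r))).
  apply/eqP; rewrite eq_le probability_le1 ?andTb /=.
  rewrite -muO; apply: le_measure; rewrite ?inE.
  - apply: mx_measurable_eq; last exact: mx_measurable_cst.
    by apply: mx_measurable_mul; [apply: mx_measurable_tr|]; exact: mx_measurable_id.
  - exact: (mpre _ (@measurable_stiefel R d r)).
  - by move=> Q /= QQ; exact: stiefel_scaled_cols.
  exact: (mpre _ (@measurable_stiefel R d r)).
move=> U UU B mB; apply: etrans (esym (XE _ mB)); apply: etrans (XE _ _) _.
  by rewrite -[X in measurable X]setTI; exact: measurable_mulmxl.
rewrite -[RHS](muU U UU); last exact: (mpre B mB).
by congr (mu _); apply/seteqP; split=> Q /=; rewrite scaled_cols_mul.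
Qed.

(** * Expectations of functions bounded on the Stiefel set *)

Section stiefel_expectation.
Context {R : realType} {d r : nat}.
Variable nu : probability (mxBorel R d r) R.
Hypothesis hnu : haar_law nu.
Local Notation S := (@stiefel R d r : set (mxBorel R d r)).
Local Notation E f := (\int[nu]_(X in S) f X).

(** The bound is asked on the Stiefel set alone, because the entries of [X] are unbounded on the
    space of all matrices; accordingly the expectation [E] integrates over that set. *)
Definition stiefel_bounded (f : 'M[R]_(d, r) -> R) : Prop :=
  measurable_fun setT (f : mxBorel R d r -> R) /\
  exists M, forall X, stiefel X -> `|f X| <= M.

Let mS : measurable S := @measurable_stiefel R d r.

Lemma stiefel_integrable f : stiefel_bounded f -> nu.-integrable S (EFin \o f).
Proof.
move=> [mf [M fM]]; apply: measurable_bounded_integrable => //.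
- by rewrite (le_lt_trans (probability_le1 _ _))// ltry.
- exact: measurable_funTS.
- exists M; split=> [|M' MM' X SX]; first exact: num_real.
  by apply: (le_trans (fM X SX)); exact: ltW.
Qed.

Lemma stiefel_bounded_cst c : stiefel_bounded (fun=> c).
Proof. by split; [exact: measurable_cst|exists `|c|]. Qed.

Lemma stiefel_boundedD f g : stiefel_bounded f -> stiefel_bounded g ->
  stiefel_bounded (fun X => f X + g X).
Proof.
move=> [mf [M fM]] [mg [N gN]]; split; first exact: measurable_funD.
exists (M + N) => X SX; apply: (le_trans (ler_normD _ _)).
by rewrite lerD ?fM ?gN.
Qed.

Lemma stiefel_boundedM f g : stiefel_bounded f -> stiefel_bounded g ->
  stiefel_bounded (fun X => f X * g X).
Proof.
move=> [mf [M fM]] [mg [N gN]]; split; first exact: measurable_funM.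
by exists (M * N) => X SX; rewrite normrM ler_pM ?fM ?gN.
Qed.

Lemma stiefel_boundedZ c f : stiefel_bounded f -> stiefel_bounded (fun X => c * f X).
Proof. by apply: stiefel_boundedM; exact: stiefel_bounded_cst. Qed.

Lemma stiefel_boundedB f g : stiefel_bounded f -> stiefel_bounded g ->
  stiefel_bounded (fun X => f X - g X).
Proof.
move=> [mf [M fM]] [mg [N gN]]; split; first exact: measurable_funB.
exists (M + N) => X SX; apply: (le_trans (ler_normB _ _)).
by rewrite lerD ?fM ?gN.
Qed.

Lemma stiefel_bounded_sum (I : Type) (s : seq I) (P : pred I) (f : I -> 'M[R]_(d, r) -> R) :
  (forall i, stiefel_bounded (f i)) -> stiefel_bounded (fun X => \sum_(i <- s | P i) f i X).
Proof.
move=> bf; elim: s => [|i s IH].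
  by under eq_fun do rewrite big_nil; exact: stiefel_bounded_cst.
under eq_fun do rewrite big_cons.
by case: (P i) => //; exact: stiefel_boundedD.
Qed.

Lemma stiefel_boundedX f n : stiefel_bounded f -> stiefel_bounded (fun X => f X ^+ n).
Proof.
move=> bf; elim: n => [|n IH]; first exact: stiefel_bounded_cst.
by under eq_fun do rewrite exprS; exact: stiefel_boundedM.
Qed.

Lemma stiefel_bounded_mul U f : orthogonal_group U -> stiefel_bounded f ->
  stiefel_bounded (fun X => f (U *m X)).
Proof.
move=> UU [mf [M fM]]; split; first exact: (measurableT_comp mf (measurable_mulmxl U)).
by exists M => X SX; apply: fM; exact/stiefel_mul.
Qed.

Lemma stiefel_exp_cst c : E (fun=> c) = c.
Proof. by rewrite Rintegral_cst// [X in _ * X](congr1 fine hnu.1) mulr1. Qed.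

Lemma stiefel_expD f g : stiefel_bounded f -> stiefel_bounded g ->
  E (fun X => f X + g X) = E f + E g.
Proof. by move=> bf bg; rewrite RintegralD//; exact: stiefel_integrable. Qed.

Lemma stiefel_expB f g : stiefel_bounded f -> stiefel_bounded g ->
  E (fun X => f X - g X) = E f - E g.
Proof. by move=> bf bg; rewrite RintegralB//; exact: stiefel_integrable. Qed.

Lemma stiefel_expZ c f : stiefel_bounded f -> E (fun X => c * f X) = c * E f.
Proof. by move=> bf; rewrite RintegralZl//; exact: stiefel_integrable. Qed.

Lemma stiefel_exp_sum (I : Type) (s : seq I) (P : pred I) (f : I -> 'M[R]_(d, r) -> R) :
  (forall i, stiefel_bounded (f i)) ->
  E (fun X => \sum_(i <- s | P i) f i X) = \sum_(i <- s | P i) E (f i).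
Proof.
move=> bf; elim: s => [|i s IH].
  by rewrite big_nil; under eq_Rintegral do rewrite big_nil; rewrite stiefel_exp_cst.
rewrite big_cons; under eq_Rintegral do rewrite big_cons.
by case: (P i) => //; rewrite stiefel_expD ?IH//; exact: stiefel_bounded_sum.
Qed.

Lemma stiefel_exp_le f g : stiefel_bounded f -> stiefel_bounded g ->
  (forall X, stiefel X -> f X <= g X) -> E f <= E g.
Proof. by move=> bf bg fg; apply: le_Rintegral => //; exact: stiefel_integrable. Qed.

Lemma stiefel_exp_eq f g : (forall X, stiefel X -> f X = g X) -> E f = E g.
Proof. by move=> fg; apply: eq_Rintegral => X /set_mem; exact: fg. Qed.

Lemma stiefel_exp_mul U f : orthogonal_group U -> stiefel_bounded f ->
  E (fun X => f (U *m X)) = E f.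
Proof.
move=> UU bf; rewrite /Rintegral; congr fine.
have [mf _] := bf.
have preS : (fun X : mxBorel R d r => (U *m X : mxBorel R d r)) @^-1` S = S.
  by apply/seteqP; split=> X /=; rewrite stiefel_mul.
have mEf : measurable_fun setT (EFin \o f : mxBorel R d r -> \bar R) by exact/measurable_EFinP.
have iEf : nu.-integrable ((fun X : mxBorel R d r => (U *m X : mxBorel R d r)) @^-1` S)
    ((EFin \o f) \o (fun X : mxBorel R d r => (U *m X : mxBorel R d r))).
  by rewrite preS; exact/stiefel_integrable/stiefel_bounded_mul.
have := integral_pushforward (measurable_mulmxl U) mEf iEf mS.
rewrite preS => <-; apply: eq_measure_integral => [|mU B mB _]; first exact: measurable_mulmxl.
exact: (hnu.2 U UU B mB).
Qed.

(** Dominated convergence in the form that differentiates an invariance identity: bounded difference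
    quotients of mean zero have a limit of mean zero. *)
Lemma stiefel_exp_cvg (f_ : nat -> 'M[R]_(d, r) -> R) f M :
  (forall n, measurable_fun setT (f_ n : mxBorel R d r -> R)) ->
  measurable_fun setT (f : mxBorel R d r -> R) ->
  (forall n X, stiefel X -> `|f_ n X| <= M) ->
  (forall X, stiefel X -> f_ n X @[n --> \oo] --> f X) ->
  (forall n, E (f_ n) = 0) -> E f = 0.
Proof.
move=> mf_ mf fM cf f0.
have bM := stiefel_bounded_cst M.
have bf n : stiefel_bounded (f_ n) by split=> //; exists M => X; exact: fM.
have h : (\int[nu]_(X in S) (f_ n X)%:E)%E @[n --> \oo] --> (\int[nu]_(X in S) (f X)%:E)%E.
  apply: (@dominated_cvg _ _ _ nu S mS _ _ (fun=> M%:E)) => //.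
  - by move=> n; apply: measurable_funTS; exact/measurable_EFinP.
  - by move=> X SX; apply: cvg_EFin; [exact: nearW|exact: cf].
  - exact: (stiefel_integrable bM).
have h0 : (\int[nu]_(X in S) (f_ n X)%:E)%E @[n --> \oo] --> 0%E.
  rewrite [X in X @ _ --> _](_ : _ = fun=> 0%E); first exact: cvg_cst.
  apply/funext => n; have := f0 n; rewrite /Rintegral => /eqP.
  rewrite fine_eq0; last exact: integrable_fin_num (stiefel_integrable (bf n)).
  by move/eqP.
by rewrite /Rintegral (cvg_unique _ h h0).
Qed.

End stiefel_expectation.

(** * Moments of the random projection *)

Section rotation_quotient.
Context {R : realType}.
Implicit Types (A B D c s : R).

Lemma normrX_sub_le m (x y : R) : 0 <= x <= 1 -> 0 <= y <= 1 ->
  `|x ^+ m - y ^+ m| <= m%:R * `|x - y|.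
Proof.
move=> /andP[x0 x1] /andP[y0 y1]; elim: m => [|m IH].
  by rewrite subrr normr0 mul0r.
have -> : x ^+ m.+1 - y ^+ m.+1 = x * (x ^+ m - y ^+ m) + (x - y) * y ^+ m.
  by rewrite !exprS; ring.
rewrite (le_trans (ler_normD _ _))// -(natr1 m) [leRHS]mulrDl mul1r !normrM lerD//.
  apply: le_trans IH; rewrite ler_piMl//.
  by rewrite ger0_norm.
by rewrite ler_piMr// normrX ger0_norm// exprn_ile1.
Qed.

(* The entries of [H^T Q H], with [Q] the Gram matrix of two rows with squared
   norms [A], [D] and product [B], and [H] the rotation of cosine [c] and sine [s]. *)
Definition rotA A B D c s := c ^+ 2 * A - 2 * c * s * B + s ^+ 2 * D.
Definition rotB A B D c s := c * s * (A - D) + (c ^+ 2 - s ^+ 2) * B.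

(** The square root is not Lipschitz at 0, so a bound on the change of [A] is not enough. Since
    [B^2 <= A D], the rotated entry lies between the squares of [c sqrt A - s sqrt D] and
    [c sqrt A + s sqrt D], and its root moves by at most [2 s]. The constant 3 accounts for the
    change of [B]. *)
Lemma rotation_quotient_bound m A B D c s :
  0 <= A <= 1 -> 0 <= D <= 1 -> B ^+ 2 <= A * D ->
  0 <= rotA A B D c s <= 1 -> c ^+ 2 + s ^+ 2 = 1 -> 0 < s -> 0 <= c ->
  `|(rotB A B D c s * Num.sqrt (rotA A B D c s) ^+ m - B * Num.sqrt A ^+ m) / s|
    <= 3 + m%:R * 2.
Proof.
move=> /andP[A0 A1] /andP[D0 D1] BAD /andP[A'0 A'1] cs s0 c0.
have s1 : s <= 1 by nra.
have c1 : c <= 1 by nra.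
have B1 : `|B| <= 1.
  by rewrite -(@ler_pXn2r _ 2) ?nnegrE// real_normK ?num_real// expr1n; nra.
rewrite normrM normfV (gtr0_norm s0) ler_pdivrMr//.
set A' := rotA A B D c s in A'0 A'1 *; set B' := rotB A B D c s.
have sq1 x : 0 <= x -> x <= 1 -> 0 <= Num.sqrt x <= 1.
  by move=> x0 x1; rewrite sqrtr_ge0 -sqrtr1 ler_wsqrtr.
set x := Num.sqrt A'; set y := Num.sqrt A.
have /andP[x0 x1] : 0 <= x <= 1 by exact: sq1.
have /andP[y0 y1] : 0 <= y <= 1 by exact: sq1.
have /andP[z0 z1] : 0 <= Num.sqrt D <= 1 by exact: sq1.
have yA : y ^+ 2 = A by rewrite sqr_sqrtr.
have xA : x ^+ 2 = A' by rewrite sqr_sqrtr.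
have zD : Num.sqrt D ^+ 2 = D by rewrite sqr_sqrtr.
have Byz : `|B| <= y * Num.sqrt D.
  rewrite -(@ler_pXn2r _ 2) ?nnegrE ?mulr_ge0// real_normK ?num_real//.
  by rewrite exprMn yA zD.
set z := Num.sqrt D in z0 z1 zD Byz.
have /andP[Bl Bu] : - (y * z) <= B <= y * z by rewrite -ler_norml.
have BB : `|B' - B| <= 3 * s.
  have -> : B' - B = s * (c * (A - D) - 2 * s * B).
    rewrite /B' /rotB; have -> : c ^+ 2 = 1 - s ^+ 2 by lra.
    by ring.
  rewrite normrM gtr0_norm// mulrC ler_pM2r// (le_trans (ler_normB _ _))//.
  rewrite !normrM (ger0_norm c0) (gtr0_norm s0) (@ger0_norm _ 2)//.
  have AD : `|A - D| <= 1 by rewrite ler_norml; lra.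
  have : c * `|A - D| <= 1 * 1 by rewrite ler_pM.
  have : s * `|B| <= 1 * 1 by rewrite ler_pM// ltW.
  lra.
have xy : `|x - y| <= 2 * s.
  have csy : 0 <= c * y + s * z by rewrite addr_ge0 ?mulr_ge0// ltW.
  have xu : x <= c * y + s * z.
    rewrite -(@ler_pXn2r _ 2) ?nnegrE// xA /A' /rotA -yA -zD.
    have : 0 <= 2 * (c * s) * (B + y * z).
      by rewrite mulr_ge0 ?mulr_ge0 ?(ltW s0)//; lra.
    nra.
  have xl : c * y - s * z <= x.
    have [neg|pos] := leP (c * y - s * z) 0; first exact: le_trans neg _.
    rewrite -(@ler_pXn2r _ 2) ?nnegrE ?(ltW pos)// xA /A' /rotA -yA -zD.
    have : 0 <= 2 * (c * s) * (y * z - B).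
      by rewrite mulr_ge0 ?mulr_ge0 ?(ltW s0)//; lra.
    nra.
  have cy : (1 - c) * y <= s * 1 by rewrite ler_pM ?subr_ge0//; nra.
  have sz : s * z <= s * 1 by rewrite ler_pM2l.
  have cy' : c * y <= 1 * y by rewrite ler_wpM2r.
  by rewrite ler_norml; apply/andP; split; lra.
have -> : B' * x ^+ m - B * y ^+ m = (B' - B) * x ^+ m + B * (x ^+ m - y ^+ m) by ring.
rewrite (le_trans (ler_normD _ _))// [leRHS]mulrDl !normrM lerD//.
  rewrite -[leRHS]mulr1 ler_pM// normrX ger0_norm// exprn_ile1//.
have := @normrX_sub_le m x y; rewrite x0 x1 y0 y1 => /(_ isT isT) h.
rewrite -[leRHS]mul1r ler_pM// (le_trans h)// -mulrA ler_wpM2l//.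
Qed.

Lemma cvgn_exp (u : nat -> R) (l : R) m :
  u n @[n --> \oo] --> l -> u n ^+ m @[n --> \oo] --> l ^+ m.
Proof.
move=> ul; elim: m => [|m IH]; first by rewrite expr0; exact: cvg_cst.
by under eq_fun do rewrite exprS; rewrite exprS; exact: cvgM.
Qed.

(** At angle 0 the derivative of [rotB] is [A - D] and that of [sqrt rotA] is [- B / sqrt A]; the
    limit is the product rule. Where [A = 0], the hypothesis [B^2 <= A D] forces [B = 0] and the
    second term is 0 on both sides. *)
Lemma rotation_quotient_cvg m A B D (c s : nat -> R) :
  0 <= A -> B ^+ 2 <= A * D -> (forall n, 0 <= rotA A B D (c n) (s n)) ->
  (forall n, c n ^+ 2 + s n ^+ 2 = 1) -> (forall n, 0 < s n) ->
  c n @[n --> \oo] --> (1 : R) -> s n @[n --> \oo] --> (0 : R) ->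
  (rotB A B D (c n) (s n) * Num.sqrt (rotA A B D (c n) (s n)) ^+ m
     - B * Num.sqrt A ^+ m) / s n @[n --> \oo] -->
  (A - D) * Num.sqrt A ^+ m - m%:R * (B ^+ 2 * Num.sqrt A ^+ m / A).
Proof.
move=> A0 BAD A'0 cs s0 c1 s00.
pose A' n := rotA A B D (c n) (s n); pose B' n := rotB A B D (c n) (s n).
pose x n := Num.sqrt (A' n); pose y := Num.sqrt A.
have s0' n : s n != 0 by rewrite gt_eqF.
have c2 n : c n ^+ 2 = 1 - s n ^+ 2 by rewrite -(cs n) addrK.
have xy : x n @[n --> \oo] --> y.
  apply: continuous_cvg; first exact: sqrt_continuous.
  suff : A' n @[n --> \oo] --> 1 ^+ 2 * A - 2 * 1 * 0 * B + 0 ^+ 2 * D.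
    by rewrite (_ : _ - _ + _ = A) //; ring.
  rewrite /A' /rotA; apply: cvgD; [apply: cvgB|]; apply: cvgMl.
  - by apply: cvgn_exp.
  - by apply: cvgM => //; apply: cvgMr.
  - exact: cvgn_exp.
have BB : (B' n - B) / s n @[n --> \oo] --> A - D.
  have -> : (fun n => (B' n - B) / s n) = (fun n => c n * (A - D) - 2 * s n * B).
    by apply/funext => n; rewrite /B' /rotB c2; field.
  suff : (fun n => c n * (A - D) - 2 * s n * B) n @[n --> \oo] --> 1 * (A - D) - 2 * 0 * B.
    by rewrite (_ : 1 * _ - _ = A - D) //; ring.
  by apply: cvgB; apply: cvgMl => //; apply: cvgMr.
have xym : x n ^+ m @[n --> \oo] --> y ^+ m by exact: cvgn_exp.
have -> : (fun n => (rotB A B D (c n) (s n) * Num.sqrt (rotA A B D (c n) (s n)) ^+ m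
     - B * Num.sqrt A ^+ m) / s n) =
   (fun n => (B' n - B) / s n * x n ^+ m + B * ((x n ^+ m - y ^+ m) / s n)).
  by apply/funext => n; rewrite -/(A' n) -/(B' n) -/(x n) -/y; field.
apply: cvgD; first exact: cvgM.
have [A00|A00] := eqVneq A 0.
  have -> : B = 0.
    apply/eqP; rewrite -sqrf_eq0 eq_le sqr_ge0 andbT.
    by move: BAD; rewrite A00 mul0r.
  rewrite expr0n/= !mul0r mulr0 oppr0.
  by under eq_fun do rewrite mul0r; exact: cvg_cst.
have y0 : 0 < y by rewrite sqrtr_gt0 lt_def A00.
have yA : y ^+ 2 = A by rewrite sqr_sqrtr.
have x0 n : 0 <= x n by exact: sqrtr_ge0.
have xys : (x n - y) / s n @[n --> \oo] --> - B / y.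
  (* Multiplication by [x n + y] replaces the roots by [A' n - A], which is divisible by [s n]. *)
  have -> : (fun n => (x n - y) / s n) =
      (fun n => (s n * (D - A) - 2 * c n * B) / (x n + y)).
    apply/funext => n; have xyn0 : x n + y != 0 by rewrite gt_eqF// ltr_wpDl.
    apply: (mulIf xyn0); rewrite divfK// mulrAC.
    have -> : (x n - y) * (x n + y) = A' n - A by rewrite -subr_sqr yA /x sqr_sqrtr //; exact: A'0.
    by rewrite /A' /rotA c2; field.
  have -> : - B / y = (0 * (D - A) - 2 * 1 * B) / (y + y).
    by rewrite -mulr2n -(mulr_natl y); field; exact: lt0r_neq0.
  apply: cvgM.
    by apply: cvgB; apply: cvgMl => //; apply: cvgMr.
  apply: cvgV; first by rewrite gt_eqF// addr_gt0.
  by apply: cvgD => //; exact: cvg_cst.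
have -> : - (m%:R * (B ^+ 2 * y ^+ m / A)) = B * (m%:R * (y ^+ m * (- B / A))).
  by field.
apply: cvgMr; elim: {xym} m => [|m IH].
  under eq_fun do rewrite subrr mul0r.
  by rewrite mul0r; exact: cvg_cst.
have -> : (fun n => (x n ^+ m.+1 - y ^+ m.+1) / s n) =
    (fun n => x n * ((x n ^+ m - y ^+ m) / s n) + (x n - y) / s n * y ^+ m).
  by apply/funext => n; rewrite !exprS; field.
have -> : m.+1%:R * (y ^+ m.+1 * (- B / A)) =
    y * (m%:R * (y ^+ m * (- B / A))) + - B / y * y ^+ m.
  by rewrite -natr1 exprS -yA; field; rewrite gt_eqF.
by apply: cvgD; [exact: cvgM|exact: cvgMl].
Qed.

End rotation_quotient.

(** * Entries of the projection and their change under reflections *)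

Section projection.
Context {R : realType} {d r : nat}.
Implicit Types (X : 'M[R]_(d, r)) (x y : 'cV[R]_d).
Local Notation e_ i := (delta_mx i ord0 : 'cV[R]_d).

(* On the Stiefel matrices this is the orthogonal projection onto the column space. *)
Definition colproj X : 'M[R]_d := (r%:R / d%:R) *: (X *m X^T).

Lemma colprojT X : (colproj X)^T = colproj X.
Proof. by rewrite /colproj [LHS]linearZ/= trmx_mul trmxK. Qed.

Lemma colproj_mul (U : 'M[R]_d) X : colproj (U *m X) = U *m colproj X *m U^T.
Proof. by rewrite /colproj trmx_mul -scalemxAr -scalemxAl !mulmxA. Qed.

Lemma mx_measurable_colproj :
  mx_measurable (fun X : mxBorel R d r => colproj X).
Proof.
apply: mx_measurable_scale; first exact: measurable_cst.
by apply: mx_measurable_mul; [|apply: mx_measurable_tr]; exact: mx_measurable_id.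
Qed.

Lemma dotp_colproj X x : (0 < r)%N -> (0 < d)%N ->
  dotp (X^T *m x) (X^T *m x) = d%:R / r%:R * dotp x (colproj X *m x).
Proof.
move=> r0 d0; rewrite /colproj -scalemxAl dotpZr mulrA.
have -> : d%:R / r%:R * (r%:R / d%:R) = 1 :> R.
  by field; rewrite !pnatr_eq0 -!lt0n r0 d0.
by rewrite mul1r /dotp trmx_mul trmxK !mulmxA.
Qed.

Hypotheses (r0 : (0 < r)%N) (rd : (r <= d)%N).

Let d0 : (0 < d)%N. Proof. exact: leq_trans rd. Qed.
Let rn0 : r%:R != 0 :> R. Proof. by rewrite pnatr_eq0 -lt0n. Qed.
Let dn0 : d%:R != 0 :> R. Proof. by rewrite pnatr_eq0 -lt0n. Qed.

Lemma colproj_idem X : stiefel X -> colproj X *m colproj X = colproj X.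
Proof.
rewrite /stiefel/= => SX; rewrite /colproj -scalemxAl -scalemxAr scalerA.
rewrite mulmxA -(mulmxA X) SX -scalemx1 -scalemxAr mulmx1 -scalemxAl scalerA.
by congr (_ *: _); field; rewrite rn0 dn0.
Qed.

Lemma mxtrace_colproj X : stiefel X -> \tr (colproj X) = r%:R.
Proof.
rewrite /stiefel/= => SX; rewrite /colproj mxtraceZ mxtrace_mulC SX mxtrace_scalar.
by rewrite -mulr_natr; field; rewrite rn0 dn0.
Qed.

Lemma dotp_colprojE X x y : stiefel X ->
  dotp x (colproj X *m y) = dotp (colproj X *m x) (colproj X *m y).
Proof.
move=> SX; rewrite -{1}(colproj_idem SX) -mulmxA.
by rewrite /dotp trmx_mul colprojT !mulmxA.
Qed.

Lemma colproj_entry X i j :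
  colproj X i j = dotp (e_ i) (colproj X *m e_ j).
Proof. by rewrite dotp_delta. Qed.

Lemma colproj_entryE X i j : stiefel X ->
  colproj X i j = dotp (colproj X *m e_ i) (colproj X *m e_ j).
Proof. by move=> SX; rewrite -dotp_colprojE// dotp_delta. Qed.

Lemma colproj_sym X i j : colproj X i j = colproj X j i.
Proof. by rewrite -{1}colprojT mxE. Qed.

Lemma colproj_ge0 X i : stiefel X -> 0 <= colproj X i i.
Proof. by move=> SX; rewrite colproj_entry (dotp_colprojE _ _ SX) dotp_ge0. Qed.

Lemma colproj_CS X i j : stiefel X -> colproj X i j ^+ 2 <= colproj X i i * colproj X j j.
Proof.
move=> SX; rewrite (colproj_entryE i j SX) (colproj_entryE i i SX) (colproj_entryE j j SX).
exact: sqr_dotp_le.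
Qed.

(** The diagonal of [Q Q^T = Q]. The bound [Q_ii <= 1], the moment recurrence and the quotient
    estimate all rest on it. *)
Lemma colproj_sum_sqr X i : stiefel X -> \sum_j colproj X i j ^+ 2 = colproj X i i.
Proof.
move=> SX; rewrite -{2}(colproj_idem SX) mxE; apply: eq_bigr => j _.
by rewrite expr2 (colproj_sym _ j i).
Qed.

Lemma colproj_diag_le1 X i : stiefel X -> colproj X i i <= 1.
Proof.
move=> SX; have := colproj_sum_sqr i SX; rewrite (bigD1 i)//= => h.
have h2 : colproj X i i ^+ 2 <= colproj X i i.
  by rewrite -{2}h lerDl sumr_ge0// => j _; exact: sqr_ge0.
have := colproj_ge0 i SX; rewrite le_eqVlt => /predU1P[<-//|p0].
by rewrite -(ler_pM2l p0) mulr1 -expr2.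
Qed.

Lemma colproj_le1 X i j : stiefel X -> `|colproj X i j| <= 1.
Proof.
move=> SX; rewrite -(@ler_pXn2r _ 2) ?nnegrE// real_normK ?num_real// expr1n.
apply: (le_trans (colproj_CS i j SX)).
by rewrite mulr_ile1 ?colproj_ge0 ?colproj_diag_le1.
Qed.

Lemma stiefel_bounded_colproj i j : stiefel_bounded (fun X => colproj X i j).
Proof.
split; first exact: mx_measurable_colproj.
by exists 1 => X; exact: colproj_le1.
Qed.

Lemma stiefel_bounded_sqrt i :
  stiefel_bounded (fun X => Num.sqrt (colproj X i i)).
Proof.
split; first by apply: measurable_sqrtr; exact: mx_measurable_colproj.
exists 1 => X SX; rewrite ger0_norm ?sqrtr_ge0// -sqrtr1 ler_wsqrtr//.
exact: colproj_diag_le1.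
Qed.

Lemma colproj_conj_entry (U : 'M[R]_d) X i j :
  colproj (U *m X) i j =
  dotp (U^T *m e_ i) (colproj X *m (U^T *m e_ j)).
Proof. by rewrite colproj_entry colproj_mul /dotp trmx_mul trmxK !mulmxA. Qed.

(** The half-angle parametrisation of the circle: [c] and [s] are the cosine and sine of twice the
    angle of tangent [t], here rational in [t]. At [t = 0] the reflection just flips [e_j]. *)
Lemma householder_delta (t : R) i j : i != j ->
  let v : 'cV[R]_d := t *: e_ i + e_ j in
  let c := (1 - t ^+ 2) / (1 + t ^+ 2) in let s := 2 * t / (1 + t ^+ 2) in
  [/\ v != 0, householder v *m e_ i = c *: e_ i - s *: e_ j &
      householder v *m e_ j = - s *: e_ i - c *: e_ j].
Proof.
move=> ij v c s; have ji : (j == i) = false by rewrite eq_sym (negPf ij).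
have vv : dotp v v = 1 + t ^+ 2.
  rewrite /v !dotpDl !dotpDr !dotpZl !dotpZr !dotp_delta1 !eqxx ji (negPf ij)/=.
  by ring.
have t1 : 1 + t ^+ 2 != 0 by rewrite lt0r_neq0// ltr_pwDl// sqr_ge0.
split; first by rewrite -dotp_eq0 vv.
- rewrite householderE vv {1}/v dotpDl dotpZl !dotp_delta1 eqxx ji/= mulr1 addr0.
  rewrite /v scalerDr opprD addrA scalerA -{1}[e_ i]scale1r -scalerBl.
  by congr (_ *: _ - _ *: _); rewrite /c; field.
- rewrite householderE vv {1}/v dotpDl dotpZl !dotp_delta1 eqxx (negPf ij)/= mulr0 add0r mulr1.
  rewrite /v scalerDr opprD addrCA scalerA -{1}[e_ j]scale1r -scalerBl -scaleNr.
  rewrite -[X in _ = _ + X]scaleNr.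
  by congr (_ *: _ + _ *: _); rewrite /c /s; field.
Qed.

(** In this plane the reflection is a rotation composed with a change of sign of the second vector,
    hence the minus sign before [rotB]. *)
Lemma colproj_rotation (t : R) i j X : i != j ->
  let H := householder (t *: e_ i + e_ j) in
  let c := (1 - t ^+ 2) / (1 + t ^+ 2) in let s := 2 * t / (1 + t ^+ 2) in
  let A := colproj X i i in let B := colproj X i j in let D := colproj X j j in
  colproj (H *m X) i i = rotA A B D c s /\
  colproj (H *m X) i j = - rotB A B D c s.
Proof.
move=> ij H c s A B D; rewrite !colproj_conj_entry householderT.
have [_ -> ->] := householder_delta t ij.
rewrite -/c -/s !mulmxBr -!scalemxAr !dotpBl !dotpBr !dotpZl !dotpZr -!colproj_entry.
rewrite -/A -/B -/D (colproj_sym X j i) -/B /rotA /rotB.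
by split; ring.
Qed.

End projection.

(** * Half-integer moments of a diagonal entry *)

Section haar_moments.
Context {R : realType} {d r : nat}.
Variable nu : probability (mxBorel R d r) R.
Hypothesis hnu : haar_law nu.
Hypotheses (r0 : (0 < r)%N) (rd : (r <= d)%N).
Local Notation S := (@stiefel R d r : set (mxBorel R d r)).
Local Notation E f := (\int[nu]_(X in S) f X).
Local Notation e_ i := (delta_mx i ord0 : 'cV[R]_d).

Let d0 : (0 < d)%N. Proof. exact: leq_trans rd. Qed.

Local Notation bP := (stiefel_bounded_colproj r0 rd).
Local Notation bS := (stiefel_bounded_sqrt r0 rd).

Lemma measurable_colproj_inv i :
  measurable_fun setT (fun X : mxBorel R d r => (colproj X i i)^-1).
Proof.
apply: measurable_inv_ge0 => [|X]; first exact: mx_measurable_colproj.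
rewrite /colproj mxE mxE mulr_ge0 ?divr_ge0// sumr_ge0// => k _.
by rewrite mxE -expr2 sqr_ge0.
Qed.

(** By Cauchy-Schwarz and [Q_jj, Q_kk <= 1] the numerator is at most [Q_ii] in absolute value, so
    small values of [Q_ii] do no harm; at 0 the quotient is 0 by convention. *)
Lemma stiefel_bounded_colproj_ratio i j k :
  stiefel_bounded (fun X : 'M[R]_(d, r) => colproj X i j * colproj X i k / colproj X i i).
Proof.
split.
  apply: measurable_funM; last exact: measurable_colproj_inv.
  by apply: measurable_funM; exact: mx_measurable_colproj.
exists 1 => X SX; have Aj := colproj_CS r0 rd i j SX; have Ak := colproj_CS r0 rd i k SX.
have A0 := colproj_ge0 r0 rd i SX.
have [A00|A00] := eqVneq (colproj X i i) 0; first by rewrite A00 invr0 mulr0 normr0.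
have Ap : 0 < colproj X i i by rewrite lt_def A00.
rewrite normrM normfV (gtr0_norm Ap)// ler_pdivrMr// mul1r.
rewrite -(@ler_pXn2r _ 2) ?nnegrE// real_normK ?num_real// exprMn.
apply: (le_trans (ler_pM (sqr_ge0 _) (sqr_ge0 _) Aj Ak)).
rewrite mulrACA -expr2 ler_piMr ?sqr_ge0// mulr_ile1 ?colproj_ge0 ?colproj_diag_le1//.
Qed.

(* The derivative at angle 0 of [E (Q_ij Q_ii^(m/2))] along rotations in the plane (i, j),
   which vanishes by invariance. *)
Lemma stiefel_exp_rotation m i j : i != j ->
  E (fun X => (colproj X i i - colproj X j j) * Num.sqrt (colproj X i i) ^+ m
    - m%:R * (colproj X i j ^+ 2 * Num.sqrt (colproj X i i) ^+ m / colproj X i i)) = 0.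
Proof.
move=> ij.
pose f (X : 'M[R]_(d, r)) := colproj X i j * Num.sqrt (colproj X i i) ^+ m.
have bf : stiefel_bounded f.
  by apply: stiefel_boundedM; [exact: bP|apply: stiefel_boundedX; exact: bS].
pose H t := householder (t *: e_ i + e_ j).
pose c (t : R) := (1 - t ^+ 2) / (1 + t ^+ 2); pose s (t : R) := 2 * t / (1 + t ^+ 2).
have HO t : orthogonal_group (H t).
  by apply: householder_orthogonal; have [] := householder_delta t ij.
pose rB t (X : 'M[R]_(d, r)) := rotB (colproj X i i) (colproj X i j) (colproj X j j) (c t) (s t).
pose rA t (X : 'M[R]_(d, r)) := rotA (colproj X i i) (colproj X i j) (colproj X j j) (c t) (s t).
have fH t X : f (H t *m X) = - (rB t X * Num.sqrt (rA t X) ^+ m).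
  rewrite /f; have [-> ->] := colproj_rotation t X ij.
  by rewrite mulNr.
have Ef t : E (fun X => f (H t *m X)) = E f by exact: stiefel_exp_mul.
(* At [t = 0] the reflection changes the sign of [Q_ij], so invariance reads [- E f = E f]. This
   absorbs the sign that reflections carry: the quotient [q] below adds [f (H X)] and [f X], and
   both have mean zero. *)
have Ef0 : E f = 0.
  have : E (fun X => - 1 * f X) = E f.
    rewrite -[RHS](Ef 0); apply: stiefel_exp_eq => X _; rewrite fH /f mulN1r.
    have c0 : c 0 = 1 by rewrite /c expr0n/= subr0 addr0 divr1.
    have s0 : s 0 = 0 by rewrite /s mulr0 mul0r.
    rewrite /rA /rB c0 s0 /rotA /rotB.
    congr (- (_ * Num.sqrt _ ^+ m)); ring.
  by rewrite stiefel_expZ//; lra.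
(* These parameters tend to 0 within []0, 1]], which keeps the cosine nonnegative and the sine
   positive. *)
pose t (n : nat) : R := n.+1%:R^-1.
have t0 n : 0 < t n by rewrite invr_gt0.
have t1 n : t n <= 1 by rewrite invf_le1// ler1n.
have tc : t n @[n --> \oo] --> (0 : R) by exact: cvg_harmonic.
have tt0 n : 1 + t n ^+ 2 != 0 by rewrite lt0r_neq0// ltr_pwDl// sqr_ge0.
have cs n : c (t n) ^+ 2 + s (t n) ^+ 2 = 1 by rewrite /c /s; field.
have s0 n : 0 < s (t n).
  by rewrite divr_gt0 ?mulr_gt0// ltr_pwDl// sqr_ge0.
have c0 n : 0 <= c (t n).
  rewrite divr_ge0//; last by rewrite addr_ge0// sqr_ge0.
  by rewrite subr_ge0 expr_le1// ltW.
have t2c : t n ^+ 2 @[n --> \oo] --> (0 : R).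
  by have := cvgn_exp (m := 2) tc; rewrite expr0n.
have tt2c : 1 + t n ^+ 2 @[n --> \oo] --> (1 : R).
  by rewrite -[X in _ --> X]addr0; apply: cvgD => //; exact: cvg_cst.
have cc : c (t n) @[n --> \oo] --> (1 : R).
  suff : c (t n) @[n --> \oo] --> ((1 - 0) / 1 : R) by rewrite subr0 divr1.
  rewrite /c.
  by apply: cvgM; [apply: cvgB => //; exact: cvg_cst|apply: cvgV => //; exact: oner_neq0].
have sc : s (t n) @[n --> \oo] --> (0 : R).
  suff : s (t n) @[n --> \oo] --> ((2 * 0) / 1 : R) by rewrite mulr0 mul0r.
  rewrite /s.
  by apply: cvgM; [exact: cvgMr|apply: cvgV => //; exact: oner_neq0].
have SH n (X : 'M[R]_(d, r)) : stiefel X -> stiefel (H (t n) *m X).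
  by move=> SX; apply/stiefel_mul => //; exact: HO.
pose q n X := (rB (t n) X * Num.sqrt (rA (t n) X) ^+ m - f X) / s (t n).
have qE n : q n = fun X => - (s (t n))^-1 * (f (H (t n) *m X) + f X).
  by apply/funext => X; rewrite /q fH; field; rewrite gt_eqF.
have bq n : stiefel_bounded (q n).
  rewrite qE; apply: stiefel_boundedZ; apply: stiefel_boundedD => //.
  exact: stiefel_bounded_mul.
pose h (X : 'M[R]_(d, r)) :=
  (colproj X i i - colproj X j j) * Num.sqrt (colproj X i i) ^+ m
    - m%:R * (colproj X i j ^+ 2 * Num.sqrt (colproj X i i) ^+ m / colproj X i i).
apply: (@stiefel_exp_cvg _ _ _ nu q h (3 + m%:R * 2)).
- by move=> n; case: (bq n).
- apply: measurable_funB; apply: measurable_funM.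
  + by apply: measurable_funB; exact: mx_measurable_colproj.
  + by have [+ _] := @stiefel_boundedX R d r _ m (bS i); exact.
  + exact: measurable_cst.
  + apply: measurable_funM; last exact: measurable_colproj_inv.
    apply: measurable_funM; last by have [+ _] := @stiefel_boundedX R d r _ m (bS i); exact.
    by have [+ _] := @stiefel_boundedX R d r _ 2 (bP i j); exact.
- move=> n X SX; apply: rotation_quotient_bound => //.
  + by rewrite colproj_ge0 ?colproj_diag_le1.
  + by rewrite colproj_ge0 ?colproj_diag_le1.
  + exact: colproj_CS.
  + have [<- _] := colproj_rotation (t n) X ij.
    by have SHX := SH n X SX; rewrite colproj_ge0 ?colproj_diag_le1.
- move=> X SX; apply: rotation_quotient_cvg => //.
  + exact: colproj_ge0.
  + exact: colproj_CS.
  + move=> n; have [<- _] := colproj_rotation (t n) X ij.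
    by have SHX := SH n X SX; rewrite colproj_ge0.
- move=> n; rewrite qE stiefel_expZ; last first.
    by apply: stiefel_boundedD => //; exact: stiefel_bounded_mul.
  rewrite stiefel_expD//; last exact: stiefel_bounded_mul.
  by rewrite Ef Ef0 addr0 mulr0.
Qed.

(** The rotation identity is summed over [j != i]. The trace gives [sum (Q_ii - Q_jj) = d Q_ii - r],
    idempotence gives [sum Q_ij^2 = Q_ii - Q_ii^2], and collecting powers of [Q_ii] leaves the
    recurrence. *)
Lemma sqrt_moment_rec m i :
  (d%:R + m%:R) * E (fun X => Num.sqrt (colproj X i i) ^+ m.+2) =
  (r%:R + m%:R) * E (fun X => Num.sqrt (colproj X i i) ^+ m).
Proof.
pose w k (X : 'M[R]_(d, r)) := Num.sqrt (colproj X i i) ^+ k.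
have bw k : stiefel_bounded (w k) by apply: stiefel_boundedX; exact: bS.
pose g j (X : 'M[R]_(d, r)) := (colproj X i i - colproj X j j) * w m X
    - m%:R * (colproj X i j ^+ 2 * w m X / colproj X i i).
have bg j : stiefel_bounded (g j).
  apply: stiefel_boundedB.
    by apply: stiefel_boundedM => //; apply: stiefel_boundedB; exact: bP.
  apply: stiefel_boundedZ.
  have -> : (fun X : 'M[R]_(d, r) => colproj X i j ^+ 2 * w m X / colproj X i i) =
      (fun X => colproj X i j * colproj X i j / colproj X i i * w m X).
    by apply/funext => X; rewrite expr2 mulrAC.
  by apply: stiefel_boundedM => //; exact: stiefel_bounded_colproj_ratio.
have Esum : E (fun X => \sum_(j | j != i) g j X) = 0.
  rewrite stiefel_exp_sum// big1// => j ji.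
  by apply: stiefel_exp_rotation; rewrite eq_sym.
have gE X : stiefel X -> \sum_(j | j != i) g j X =
    (d%:R + m%:R) * w m.+2 X - (r%:R + m%:R) * w m X.
  move=> SX; have A0 := colproj_ge0 r0 rd i SX.
  have w2 : w m.+2 X = colproj X i i * w m X.
    by rewrite /w -addn2 exprD sqr_sqrtr// mulrC.
  have sumD : \sum_(j | j != i) (colproj X i i - colproj X j j) =
      d%:R * colproj X i i - r%:R.
    have := mxtrace_colproj r0 rd SX; rewrite /mxtrace (bigD1 i)//= => <-.
    rewrite sumrB sumr_const.
    have -> : #|(fun j : 'I_d => j != i)| = d.-1.
      by have := cardC1 i; rewrite card_ord.
    have -> : d%:R = d.-1%:R + 1 :> R by rewrite natr1 prednK.
    by rewrite -mulr_natl; ring.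
  rewrite /g big_split/= sumrN -mulr_suml -mulr_sumr sumD.
  have -> : \sum_(j | j != i) colproj X i j ^+ 2 * w m X / colproj X i i =
      (\sum_(j | j != i) colproj X i j ^+ 2) * w m X / colproj X i i.
    by rewrite !mulr_suml.
  have := colproj_sum_sqr r0 rd i SX; rewrite (bigD1 i)//= => sqrE.
  have -> : \sum_(j | j != i) colproj X i j ^+ 2 = colproj X i i - colproj X i i ^+ 2 by lra.
  rewrite w2.
  (* Where [Q_ii = 0], the power [w m] is 1 for [m = 0] and 0 otherwise, so the two cases are
     checked apart. *)
  have [A00|A00] := eqVneq (colproj X i i) 0; last by field.
  rewrite /w A00 sqrtr0 expr0n; case: (m) => [|k] /=; first by ring.
  by ring.
have : E (fun X => (d%:R + m%:R) * w m.+2 X - (r%:R + m%:R) * w m X) = 0.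
  by rewrite -Esum; apply/esym/stiefel_exp_eq.
rewrite stiefel_expB; [|exact: stiefel_boundedZ|exact: stiefel_boundedZ].
by rewrite !stiefel_expZ// => /eqP; rewrite subr_eq0 => /eqP.
Qed.

(** As [(d/r) Q_ii] is the squared norm of [P^T e_i], this identifies [tau] with the mean of that
    norm. The moments decrease in [m] because [Q_ii <= 1]. *)
Lemma stiefel_exp_sqrt i :
  Num.sqrt (d%:R / r%:R) * E (fun X => Num.sqrt (colproj X i i)) = tau R d r.
Proof.
rewrite /tau natr1 natr1 -!mulrA; congr (_ * _).
pose W m := E (fun X => Num.sqrt (colproj X i i) ^+ m).
rewrite mulrA -(half_moment_Gamma (W := W) r0 rd).
- by apply: stiefel_exp_eq => X _.
- by rewrite /W; under eq_Rintegral do rewrite expr0; rewrite stiefel_exp_cst.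
- move=> m; apply: stiefel_exp_le; [by apply: stiefel_boundedX; exact: bS..|].
  move=> X SX; rewrite exprS ler_piMl ?exprn_ge0 ?sqrtr_ge0// -sqrtr1 ler_wsqrtr//.
  exact: colproj_diag_le1.
- by move=> m; exact: sqrt_moment_rec.
Qed.

End haar_moments.

Section opnorm.
Context {R : realType} {d : nat}.
Implicit Types (A : 'M[R]_d) (x : 'cV[R]_d).

(** The Frobenius norm is an upper bound, by Cauchy-Schwarz on each row, so the supremum in [opnorm]
    is a genuine one. *)
Lemma opnorm_has_sup A : has_sup [set enorm (A *m x) | x in [set x | enorm x <= 1]].
Proof.
split; first by exists (enorm (A *m 0)); exists 0 => //=; rewrite /enorm /dotp mulmx0 mxE sqrtr0.
exists (Num.sqrt (\sum_i dotp (row i A)^T (row i A)^T)) => _ [x /= x1 <-].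
apply: ler_wsqrtr; rewrite dotpE; apply: ler_sum => i _.
have -> : (A *m x) i ord0 = dotp (row i A)^T x.
  by rewrite /dotp trmxK -row_mul [RHS]mxE.
rewrite -expr2; apply: (le_trans (sqr_dotp_le _ _)).
by rewrite ler_piMr ?dotp_ge0// -sqr_enorm expr_le1// enorm_ge0.
Qed.

Lemma enorm_mulmx_le A x : enorm x <= 1 -> enorm (A *m x) <= opnorm A.
Proof.
by move=> x1; apply: ub_le_sup; [have [] := opnorm_has_sup A|exists x].
Qed.

Lemma dotp_mulmx_le_opnorm A x : enorm x = 1 -> dotp x (A *m x) <= opnorm A.
Proof.
move=> x1; apply: (le_trans (dotp_le_enorm _ _)).
by rewrite x1 mul1r enorm_mulmx_le ?x1.
Qed.

Lemma enorm_delta (i : 'I_d) : enorm (delta_mx i ord0 : 'cV[R]_d) = 1.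
Proof. by rewrite /enorm dotp_delta1 eqxx sqrtr1. Qed.

Lemma opnorm_gt0 A : A != 0 -> 0 < opnorm A.
Proof.
move=> A0; have [j Aj] : exists j, A *m (delta_mx j ord0 : 'cV[R]_d) != 0.
  apply/existsP; apply: contraR A0; rewrite negb_exists => /forallP h.
  apply/eqP/matrixP => i j; rewrite mxE -dotp_delta.
  by have := h j; rewrite negbK => /eqP ->; rewrite /dotp mulmx0 mxE.
apply: (@lt_le_trans _ _ (enorm (A *m (delta_mx j ord0 : 'cV[R]_d)))).
  by rewrite lt_def enorm_ge0 enorm_eq0 Aj.
by rewrite enorm_mulmx_le// enorm_delta.
Qed.

End opnorm.

(** * Mean quadratic form of a normalised column of the projection *)

Section haar_quadratic.
Context {R : realType} {d r : nat}.
Variable nu : probability (mxBorel R d r) R.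
Hypothesis hnu : haar_law nu.
Hypotheses (r0 : (0 < r)%N) (rd : (r <= d)%N).
Local Notation S := (@stiefel R d r : set (mxBorel R d r)).
Local Notation E f := (\int[nu]_(X in S) f X).
Local Notation e_ i := (delta_mx i ord0 : 'cV[R]_d).

Let d0 : (0 < d)%N. Proof. exact: leq_trans rd. Qed.
Let dn0 : d%:R != 0 :> R. Proof. by rewrite pnatr_eq0 -lt0n. Qed.

Local Notation bP := (stiefel_bounded_colproj r0 rd).
Local Notation bR := (stiefel_bounded_colproj_ratio r0 rd).

Lemma householder_orth (v x : 'cV[R]_d) : dotp v x = 0 -> householder v *m x = x.
Proof. by move=> vx; rewrite householderE vx mulr0 mul0r scale0r subr0. Qed.

Lemma delta_neq0 i : e_ i != 0.
Proof. by rewrite -dotp_eq0 dotp_delta1 eqxx oner_neq0. Qed.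

Lemma householder_flip i : householder (e_ i) *m e_ i = - e_ i.
Proof.
rewrite householderE dotp_delta1 eqxx/= divr1 mulr1 scaler_nat mulr2n opprD addrA.
by rewrite subrr add0r.
Qed.

Lemma delta_sub_neq0 (a b : 'I_d) : a != b -> e_ a - e_ b != 0.
Proof.
move=> ab; rewrite subr_eq0; apply/eqP => /(congr1 (dotp (e_ a))) /eqP.
by rewrite !dotp_delta1 eqxx (negPf ab) oner_eq0.
Qed.

Lemma householder_swap (a b k : 'I_d) : a != b ->
  householder (e_ a - e_ b) *m e_ k = e_ (if k == a then b else if k == b then a else k).
Proof.
move=> ab; have eab : e_ a != e_ b.
  by rewrite -subr_eq0 delta_sub_neq0.
have Ha : householder (e_ a - e_ b) *m e_ a = e_ b.
  by apply: householder_reflect => //; rewrite !dotp_delta1 !eqxx.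
have [->//|ka] := eqVneq k a.
have [->|kb] := eqVneq k b.
  by rewrite -[X in _ *m X = _]Ha mulmxA householderK ?subr_eq0// mul1mx.
apply: householder_orth.
by rewrite dotpBl !dotp_delta1 ![_ == k]eq_sym (negPf ka) (negPf kb) subrr.
Qed.

Lemma colproj_householder v (X : 'M[R]_(d, r)) i j : colproj (householder v *m X) i j =
  dotp (householder v *m e_ i) (colproj X *m (householder v *m e_ j)).
Proof. by rewrite colproj_conj_entry householderT. Qed.

(** As [j != k], one of them differs from [i], and by symmetry it may be [j]. Flipping coordinate
    [j] changes the sign of [Q_ij] and fixes [Q_ik] and [Q_ii], so the mean equals its opposite. *)
Lemma stiefel_exp_ratio_offdiag i j k : j != k ->
  E (fun X => colproj X i j * colproj X i k / colproj X i i) = 0.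
Proof.
wlog ji : j k / j != i => [wl|jk].
  have [ji jk|ji] := eqVneq j i; last exact: wl.
  have kj : k != j by rewrite eq_sym.
  have ki : k != i by rewrite -ji.
  rewrite -[RHS](wl k j ki kj).
  by apply: stiefel_exp_eq => X _; rewrite (mulrC (colproj X i j)).
set f := fun X => _.
have bf : stiefel_bounded f by exact: bR.
have Hk l : l != j -> householder (e_ j) *m e_ l = e_ l.
  by move=> lj; rewrite householder_orth// dotp_delta1 eq_sym (negPf lj).
have : E (fun X => f (householder (e_ j) *m X)) = E f.
  by apply: stiefel_exp_mul => //; apply: householder_orthogonal; exact: delta_neq0.
have -> : (fun X => f (householder (e_ j) *m X)) = (fun X => - 1 * f X).
  apply/funext => X; rewrite /f !colproj_householder householder_flip !Hk ?[_ == j]eq_sym//.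
  by rewrite mulmxN dotpNr -!colproj_entry mulN1r !mulNr.
by rewrite stiefel_expZ//; lra.
Qed.

(** Exchanging coordinates shows that the [d] diagonal means agree, and the trace makes their sum
    [r]. *)
Lemma stiefel_exp_colproj_diag i : E (fun X => colproj X i i) = r%:R / d%:R.
Proof.
have eqE a b : E (fun X => colproj X a a) = E (fun X => colproj X b b).
  have [->//|ab] := eqVneq a b.
  have H0 : e_ a - e_ b != 0 by exact: delta_sub_neq0.
  rewrite -(stiefel_exp_mul hnu (householder_orthogonal H0) (bP b b)).
  apply: stiefel_exp_eq => X _.
  rewrite colproj_householder householder_swap// eqxx.
  by rewrite [b == a]eq_sym (negPf ab) -colproj_entry.
have : \sum_(j < d) E (fun X => colproj X j j) = r%:R.
  rewrite -(stiefel_exp_sum hnu); last by move=> j; exact: bP.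
  rewrite -[RHS](stiefel_exp_cst hnu); apply: stiefel_exp_eq => X SX.
  exact: mxtrace_colproj.
under eq_bigr => j _ do rewrite (eqE j i).
rewrite sumr_const card_ord => h; apply: (mulIf dn0); rewrite divfK // -h.
exact: mulr_natr.
Qed.

Lemma stiefel_exp_ratio_diag i :
  E (fun X => colproj X i i * colproj X i i / colproj X i i) = r%:R / d%:R.
Proof.
rewrite -(stiefel_exp_colproj_diag i); apply: stiefel_exp_eq => X _.
have [->|A0] := eqVneq (colproj X i i) 0; first by rewrite !mul0r.
by rewrite mulfK.
Qed.

(** Exchanging coordinates other than [i] shows that the [d - 1] means agree. With the diagonal mean
    [r/d] they add up to the mean of [sum_k Q_ik^2 / Q_ii], which is 1 where [Q_ii != 0] and 0
    elsewhere, hence an inequality. *)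
Lemma stiefel_exp_ratio_le i j : j != i -> (1 < d)%N ->
  E (fun X => colproj X i j * colproj X i j / colproj X i i) <=
  (1 - r%:R / d%:R) / (d%:R - 1).
Proof.
move=> ji d1.
pose N j := E (fun X => colproj X i j * colproj X i j / colproj X i i).
have eqN k : k != i -> N k = N j.
  move=> ki; have [->//|kj] := eqVneq k j.
  have H0 : e_ k - e_ j != 0 by exact: delta_sub_neq0.
  rewrite /N -(stiefel_exp_mul hnu (householder_orthogonal H0) (bR i j j)).
  apply: stiefel_exp_eq => X _.
  rewrite !colproj_householder !householder_swap// eqxx.
  by rewrite [j == k]eq_sym (negPf kj) ![i == _]eq_sym (negPf ji) (negPf ki) -!colproj_entry.
have : \sum_k N k <= 1.
  rewrite -(stiefel_exp_sum hnu); last by move=> k; exact: bR.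
  rewrite -[leRHS](stiefel_exp_cst hnu); apply: stiefel_exp_le.
  - by apply: stiefel_bounded_sum => k; exact: bR.
  - exact: stiefel_bounded_cst.
  move=> X SX; rewrite -mulr_suml; under eq_bigr do rewrite -expr2.
  rewrite colproj_sum_sqr//.
  have [->|A0] := eqVneq (colproj X i i) 0; first by rewrite mul0r.
  by rewrite divff.
rewrite (bigD1 i)//= {1}/N stiefel_exp_ratio_diag (eq_bigr (fun=> N j)) => [|k ki]; last exact: eqN.
rewrite sumr_const; have -> : #|(fun j : 'I_d => j != i)| = d.-1.
  by have := cardC1 i; rewrite card_ord.
have d1' : 0 < d%:R - 1 :> R by rewrite subr_gt0 ltr1n.
move=> h; rewrite ler_pdivlMr// -/(N j).
have -> : d%:R - 1 = d.-1%:R :> R by rewrite -[in LHS](prednK d0) -natr1 addrK.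
by rewrite lerBrDl mulr_natr.
Qed.

(** After expansion only the diagonal of [A] survives the expectation, and its nonnegativity lets
    [stiefel_exp_ratio_le] be applied term by term. *)
Lemma stiefel_exp_quadratic (A : 'M[R]_d) i : (1 < d)%N -> (forall j, 0 <= A j j) ->
  stiefel_bounded (fun X : 'M[R]_(d, r) => dotp (colproj X *m e_ i) (A *m (colproj X *m e_ i)) / colproj X i i) /\
  E (fun X => dotp (colproj X *m e_ i) (A *m (colproj X *m e_ i)) / colproj X i i) <=
  r%:R / d%:R * A i i + (1 - r%:R / d%:R) / (d%:R - 1) * (\tr A - A i i).
Proof.
move=> d1 A0.
pose f j k (X : 'M[R]_(d, r)) := colproj X i j * colproj X i k / colproj X i i.
have -> : (fun X : 'M[R]_(d, r) => dotp (colproj X *m e_ i) (A *m (colproj X *m e_ i)) / colproj X i i) =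
    (fun X => \sum_j \sum_k A j k * f j k X).
  apply/funext => X; rewrite dotpE mulr_suml; apply: eq_bigr => j _.
  have col k : (colproj X *m e_ i) k ord0 = colproj X i k.
    by rewrite -colE mxE colproj_sym.
  rewrite col [(A *m _) j ord0]mxE mulr_sumr mulr_suml; apply: eq_bigr => k _.
  by rewrite col /f; ring.
have bf j : stiefel_bounded (fun X => \sum_k A j k * f j k X).
  by apply: stiefel_bounded_sum => k; apply: stiefel_boundedZ; exact: bR.
split; first exact: stiefel_bounded_sum.
rewrite stiefel_exp_sum//.
have Ej j : E (fun X => \sum_k A j k * f j k X) = A j j * E (f j j).
  rewrite stiefel_exp_sum//; last by move=> k; apply: stiefel_boundedZ; exact: bR.
  rewrite (bigD1 j)//= big1 ?addr0 => [|k kj]; rewrite stiefel_expZ; try exact: bR.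
    by [].
  by rewrite stiefel_exp_ratio_offdiag ?mulr0// eq_sym.
have -> : \tr A - A i i = \sum_(j | j != i) A j j.
  by rewrite /mxtrace (bigD1 i)//= [LHS]addrC addKr.
rewrite (eq_bigr _ (fun j _ => Ej j)) (bigD1 i)//= stiefel_exp_ratio_diag.
rewrite [A i i * _]mulrC lerD2l mulr_sumr ler_sum// => j ji.
by rewrite mulrC ler_wpM2r// stiefel_exp_ratio_le.
Qed.

End haar_quadratic.

(** * The two expectations for an arbitrary gradient *)

Section haar_direction.
Context {R : realType} {d r : nat}.
Variable nu : probability (mxBorel R d r) R.
Hypothesis hnu : haar_law nu.
Hypotheses (r0 : (0 < r)%N) (rd : (r <= d)%N).
Local Notation S := (@stiefel R d r : set (mxBorel R d r)).
Local Notation E f := (\int[nu]_(X in S) f X).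
Local Notation e_ i := (delta_mx i ord0 : 'cV[R]_d).
Implicit Types (X : 'M[R]_(d, r)) (g : 'cV[R]_d).

Let d0 : (0 < d)%N. Proof. exact: leq_trans rd. Qed.
Let i0 : 'I_d := Ordinal d0.
Let cp : 0 < d%:R / r%:R :> R. Proof. by rewrite divr_gt0 ?ltr0n. Qed.

(** The complement of the Stiefel set is null, so the integral over all matrices, in which Tonelli
    is phrased, is the real expectation used so far. *)
Lemma stiefel_integral (f : 'M[R]_(d, r) -> R) : stiefel_bounded f ->
  (forall X, 0 <= f X) -> (\int[nu]_X (f X)%:E = (E f)%:E)%E.
Proof.
move=> bf f0; have mS := @measurable_stiefel R d r.
rewrite (@ge0_negligible_integral _ _ _ nu setT (~` S))//.
- rewrite setTD setCK /Rintegral fineK//.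
  by apply: integrable_fin_num => //; exact: stiefel_integrable.
- exact: measurableC.
- by apply/measurable_EFinP; case: bf.
- by move=> X _; rewrite lee_fin.
- apply: (etrans (probability_setC nu mS)).
  by rewrite [X in (_ - X)%E](_ : _ = 1%E) ?subee//; exact: hnu.1.
Qed.

Lemma orthogonal_to_delta g i : exists U : 'M[R]_d,
  [/\ orthogonal_group U, U *m U^T = 1%:M & g = enorm g *: (U^T *m e_ i)].
Proof.
have gg : dotp g g = dotp (enorm g *: e_ i) (enorm g *: e_ i).
  by rewrite dotpZl dotpZr dotp_delta1 eqxx mulr1 -expr2 sqr_enorm.
(* If [g] already equals [|g| e_i], in particular if [g = 0], the reflection vector vanishes and the
   identity serves. *)
have [gE|gE] := eqVneq g (enorm g *: e_ i).
  exists 1%:M; rewrite /orthogonal_group/= !trmx1 !mul1mx; split=> //.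
exists (householder (g - enorm g *: e_ i)).
have v0 : g - enorm g *: e_ i != 0 by rewrite subr_eq0.
rewrite /orthogonal_group/= !householderT !householderK//; split=> //.
rewrite scalemxAr.
apply: etrans (congr1 (mulmx (householder _)) (householder_reflect gE gg)).
by rewrite mulmxA householderK// mul1mx.
Qed.

Lemma enorm_trmx_mul U X g i : g = enorm g *: (U^T *m e_ i) ->
  enorm (X^T *m g) =
  enorm g * (Num.sqrt (d%:R / r%:R) * Num.sqrt (colproj (U *m X) i i)).
Proof.
move=> gE; rewrite {1}gE -scalemxAr enormZ ger0_norm ?enorm_ge0//; congr (_ * _).
rewrite mulmxA -trmx_mul /enorm dotp_colproj// sqrtrM ?(ltW cp)//.
by rewrite -colproj_entry.
Qed.

Lemma haar_enorm g :
  (\int[nu]_X (enorm (X^T *m g))%:E = (tau R d r * enorm g)%:E)%E.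
Proof.
have [U [UU _ gE]] := orthogonal_to_delta g i0.
pose f X := enorm g * (Num.sqrt (d%:R / r%:R) * Num.sqrt (colproj X i0 i0)).
have bf : stiefel_bounded f.
  by do 2 apply: stiefel_boundedZ; exact: stiefel_bounded_sqrt.
under eq_integral do rewrite (enorm_trmx_mul _ gE).
rewrite (stiefel_integral (f := fun X => f (U *m X))).
- rewrite (stiefel_exp_mul hnu UU bf) /f !stiefel_expZ//; last 2 first.
  + exact: stiefel_bounded_sqrt.
  + by apply: stiefel_boundedZ; exact: stiefel_bounded_sqrt.
  by rewrite stiefel_exp_sqrt// mulrC.
- exact: stiefel_bounded_mul.
- by move=> X; rewrite !mulr_ge0 ?enorm_ge0 ?sqrtr_ge0.
Qed.

Lemma dotp_rsngd_dir (A : 'M[R]_d) X g :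
  dotp (rsngd_dir X g) (A *m rsngd_dir X g) =
  dotp (X *m X^T *m g) (A *m (X *m X^T *m g)) / dotp (X^T *m g) (X^T *m g).
Proof.
rewrite /rsngd_dir; case: ifPn => [/eqP Xg0|Xg0].
  by rewrite -[X *m X^T *m g]mulmxA Xg0 !mulmx0 /dotp !mulmx0 mxE mul0r.
by rewrite -scalemxAr dotpZl dotpZr -[X in _ / X]sqr_enorm mulrA -invfM -expr2 mulrC.
Qed.

(** Moving [g] to [|g| e_i] replaces [A] by [B = U A U^T], of the same trace. The bound of
    [stiefel_exp_quadratic] has slope [(r - 1)/(d - 1) >= 0] in [B_ii]; at [B_ii = opnorm A], times
    [d/r], it is [ell r A] times [opnorm A]. *)
Lemma haar_quadratic (A : 'M[R]_d) g : (1 < d)%N -> A != 0 -> psd A ->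
  (\int[nu]_X (dotp (rsngd_dir X g) (A *m rsngd_dir X g))%:E <= (ell r A * opnorm A)%:E)%E.
Proof.
move=> d1 A0 [AT Apsd].
have op0 := opnorm_gt0 A0.
have trA0 : 0 <= \tr A.
  by rewrite /mxtrace sumr_ge0// => i _; rewrite -dotp_delta.
have d1' : 0 < d%:R - 1 :> R by rewrite subr_gt0 ltr1n.
have rp : 0 < r%:R :> R by rewrite ltr0n.
have dp : 0 < d%:R :> R by rewrite ltr0n.
have rdR : r%:R <= d%:R :> R by rewrite ler_nat.
have r1 : 1 <= r%:R :> R by rewrite ler1n.
have ellE : ell r A * opnorm A = d%:R / r%:R * (r%:R / d%:R * opnorm A
    + (1 - r%:R / d%:R) / (d%:R - 1) * (\tr A - opnorm A)).
  rewrite /ell /reff; field.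
  by rewrite !gt_eqF.
have ell_ge x : 0 <= x <= opnorm A -> d%:R / r%:R * (r%:R / d%:R * x
    + (1 - r%:R / d%:R) / (d%:R - 1) * (\tr A - x)) <= ell r A * opnorm A.
  move=> /andP[x0 xop]; rewrite ellE ler_pM2l// -subr_ge0.
  have -> : r%:R / d%:R * opnorm A + (1 - r%:R / d%:R) / (d%:R - 1) * (\tr A - opnorm A)
    - (r%:R / d%:R * x + (1 - r%:R / d%:R) / (d%:R - 1) * (\tr A - x)) =
    (r%:R - 1) / (d%:R - 1) * (opnorm A - x).
    by field; rewrite !gt_eqF.
  by rewrite mulr_ge0 ?divr_ge0 ?subr_ge0// ler1n.
(* The direction is 0 here, and [ell_ge] at [x = 0] with [tr A >= 0] shows that the right side is
   nonnegative. *)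
have [->|g0] := eqVneq g 0.
  rewrite integral0_eq.
    rewrite lee_fin; apply: le_trans (ell_ge 0 _); last by rewrite lexx ltW.
    rewrite mulr_ge0 ?divr_ge0// mulr0 add0r subr0 !mulr_ge0 ?invr_ge0 ?(ltW d1')//.
    by rewrite subr_ge0 ler_pdivrMr// mul1r.
  by move=> X _; rewrite /rsngd_dir mulmx0 eqxx /dotp !mulmx0 mxE.
have [U [UU UU' gE]] := orthogonal_to_delta g i0.
have gp : enorm g != 0 by rewrite enorm_eq0.
pose B := U *m A *m U^T.
have BE j : B j j = dotp (U^T *m e_ j) (A *m (U^T *m e_ j)).
  by rewrite -dotp_delta /B /dotp trmx_mul trmxK !mulmxA.
have Uj j : enorm (U^T *m e_ j) = 1.
  by rewrite /enorm /dotp trmx_mul trmxK mulmxA -(mulmxA _ U) UU' mulmx1 -/(dotp _ _) dotp_delta1 eqxx sqrtr1.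
have B0 j : 0 <= B j j by rewrite BE.
have [bq Eq] := stiefel_exp_quadratic hnu r0 rd i0 d1 B0.
set q := fun X => _ in bq Eq.
have qE X : dotp (rsngd_dir X g) (A *m rsngd_dir X g) = d%:R / r%:R * q (U *m X).
  rewrite dotp_rsngd_dir.
  have XgE : X^T *m g = enorm g *: ((U *m X)^T *m e_ i0).
    by rewrite {1}gE -scalemxAr mulmxA -trmx_mul.
  have XXgE : X *m X^T *m g = (enorm g * (d%:R / r%:R)) *: (U^T *m (colproj (U *m X) *m e_ i0)).
    rewrite -mulmxA XgE -scalemxAr -scalerA; congr (_ *: _).
    rewrite /colproj -scalemxAl -scalemxAr scalerA.
    have -> : d%:R / r%:R * (r%:R / d%:R) = 1 :> R by field; rewrite !gt_eqF.
    by rewrite scale1r !mulmxA UU mul1mx.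
  rewrite XXgE XgE -scalemxAr !dotpZl !dotpZr dotp_colproj// -colproj_entry.
  have -> : dotp (U^T *m (colproj (U *m X) *m e_ i0)) (A *m (U^T *m (colproj (U *m X) *m e_ i0))) =
     dotp (colproj (U *m X) *m e_ i0) (B *m (colproj (U *m X) *m e_ i0)).
    by rewrite /B /dotp trmx_mul trmxK !mulmxA.
  rewrite /q; set a := dotp _ _; set b := colproj _ _ _.
  have [->|b0] := eqVneq b 0; first by rewrite !mulr0 !invr0 !mulr0.
  by field; rewrite b0 gp ?(gt_eqF rp) ?(gt_eqF dp).
under eq_integral do rewrite qE.
rewrite (stiefel_integral (f := fun X => d%:R / r%:R * q (U *m X))).
- rewrite lee_fin stiefel_expZ; last exact: stiefel_bounded_mul.
  rewrite stiefel_exp_mul//; apply: le_trans (ell_ge (B i0 i0) _).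
    rewrite ler_pM2l//.
    have -> : \tr A = \tr B by rewrite /B mxtrace_mulC mulmxA UU mul1mx.
    exact: Eq.
  by rewrite B0 BE dotp_mulmx_le_opnorm.
- by apply: stiefel_boundedZ; exact: stiefel_bounded_mul.
- by move=> X; rewrite -qE Apsd.
Qed.

End haar_direction.

(** * Independence of the iterates from the next matrices *)

Section pair_law.
Context {d1 d2 : measure_display} {T1 : measurableType d1} {T2 : measurableType d2}.
Context {R : realType}.

Lemma pair_measure_unique (m1 m2 : {measure set (T1 * T2) -> \bar R}) :
  (forall A B, measurable A -> measurable B -> m1 (A `*` B) = m2 (A `*` B)) ->
  (m1 setT < +oo)%E -> forall Z, measurable Z -> m1 Z = m2 Z.
Proof.
move=> m12 m1oo Z mZ.
pose G := [set A `*` B | A in @measurable d1 T1 & B in @measurable d2 T2].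
apply: (measure_unique G (fun=> setT)) => //.
- exact: measurable_prod_measurableType.
- move=> _ _ [A mA [B mB <-]] [A' mA' [B' mB' <-]].
  exists (A `&` A'); first exact: measurableI.
  by exists (B `&` B'); [exact: measurableI|rewrite setXI].
- by move=> _; exists setT => //; exists setT => //; rewrite setXTT.
- by rewrite bigcup_const.
- by move=> _ [A mA [B mB <-]]; exact: m12.
Qed.

(** Phrased for two measures on one space, so as to compare [Pr] restricted to an event with [Pr]
    scaled by the probability of that event. *)
Lemma pair_law_unique {d0 : measure_display} {W : measurableType d0}
    (mu1 mu2 : {measure set W -> \bar R}) (X : W -> T1) (Y : W -> T2) :
  measurable_fun setT X -> measurable_fun setT Y ->
  (forall A B, measurable A -> measurable B ->
     mu1 (X @^-1` A `&` Y @^-1` B) = mu2 (X @^-1` A `&` Y @^-1` B)) ->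
  (mu1 setT < +oo)%E -> forall Z, measurable Z ->
  mu1 ((fun w => (X w, Y w)) @^-1` Z) = mu2 ((fun w => (X w, Y w)) @^-1` Z).
Proof.
move=> mX mY m12 m1oo Z mZ.
have mXY : measurable_fun setT (fun w => (X w, Y w)) by exact: measurable_fun_pair.
apply: (pair_measure_unique (m1 := pushforward mu1 (fun w => (X w, Y w)))
  (m2 := pushforward mu2 (fun w => (X w, Y w)))) => //.
Qed.

End pair_law.

Section recursion_independence.
Context {dO dT dS : measure_display} {Omega : measurableType dO}.
Context {T : measurableType dT} {S : measurableType dS} {R : realType}.
Variables (Pr : probability Omega R) (P : nat -> {RV Pr >-> S}).
Hypothesis indP : mutually_independent P.
Variables (h : T -> S -> T) (x0 : T) (x : nat -> Omega -> T).
Hypothesis mh : measurable_fun setT (fun z : T * S => h z.1 z.2).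
Hypothesis x_0 : forall w, x 0%N w = x0.
Hypothesis x_S : forall k w, x k.+1 w = h (x k w) (P k w).

Lemma measurable_recursion k : measurable_fun setT (x k).
Proof.
elim: k => [|k IH].
  have -> : x 0%N = fun=> x0 by apply/funext => w; exact: x_0.
  exact: measurable_cst.
have -> : x k.+1 = (fun z : T * S => h z.1 z.2) \o (fun w => (x k w, P k w)).
  by apply/funext => w; exact: x_S.
by apply: measurableT_comp => //; apply: measurable_fun_pair.
Qed.

Let mpre (B : nat -> set S) (J : {fset nat}) : (forall i, i \in J -> measurable (B i)) ->
  measurable (\bigcap_(i in [set` J]) (P i @^-1` B i)).
Proof.
move=> mB; apply: fin_bigcap_measurable; first exact: finite_fset.
by move=> i iJ; apply: measurable_funPTI; apply: mB.
Qed.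

Let bigcap_fset1 k (C : set S) :
  \bigcap_(i in [set` [fset k]%fset]) (P i @^-1` C) = P k @^-1` C.
Proof.
apply/seteqP; split=> [w h'|w PC i /=]; first by apply: h'; rewrite /= inE.
by rewrite inE => /eqP ->.
Qed.

Let independent_cons k (J : {fset nat}) (B : nat -> set S) (C : set S) : k \notin J ->
  measurable C -> (forall i, i \in J -> measurable (B i)) ->
  Pr (P k @^-1` C `&` \bigcap_(i in [set` J]) (P i @^-1` B i)) =
  (Pr (P k @^-1` C) * Pr (\bigcap_(i in [set` J]) (P i @^-1` B i)))%E.
Proof.
move=> kJ mC mB; pose B1 i := if i == k then C else B i.
have Jk i : i \in J -> (i == k) = false by move=> iJ; apply: contraNF kJ => /eqP <-.
have mB1 i : i \in (k |` J)%fset -> measurable (B1 i).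
  by rewrite !inE /B1; case: eqP => //= _; exact: mB.
have := indP mB1; rewrite big_fsetU1//= {2}/B1 eqxx.
rewrite (_ : (\prod_(i <- J) _)%E = Pr (\bigcap_(i in [set` J]) (P i @^-1` B i))); last first.
  by rewrite indP//; apply: eq_big_seq => i iJ; rewrite /B1 Jk.
move=> <-; congr (Pr _); apply/seteqP; split=> [w [PC PB] i /=|w h'].
  by rewrite !inE /B1; case: eqP => [->//|_ /= iJ]; exact: PB.
split; first by have := h' k; rewrite /= !inE /B1 eqxx; exact.
move=> i /= iJ; have := h' i; rewrite /= !inE /B1 iJ orbT Jk//; exact.
Qed.

(* Independence from all later matrices at once is what makes the induction on [k] work. *)
Lemma recursion_independent k (A : set T) (J : {fset nat}) (B : nat -> set S) :
  measurable A -> (forall i, i \in J -> (k <= i)%N) ->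
  (forall i, i \in J -> measurable (B i)) ->
  Pr (x k @^-1` A `&` \bigcap_(i in [set` J]) (P i @^-1` B i)) =
  (Pr (x k @^-1` A) * Pr (\bigcap_(i in [set` J]) (P i @^-1` B i)))%E.
Proof.
elim: k A J B => [|k IH] A J B mA kJ mB.
  have [xA|xA] := pselect (A x0).
    have -> : x 0%N @^-1` A = setT by apply/seteqP; split=> // w _ /=; rewrite x_0.
    by rewrite setTI probability_setT mul1e.
  have -> : x 0%N @^-1` A = set0.
    by apply/seteqP; split=> // w /=; rewrite x_0.
  by rewrite set0I measure0 mul0e.
have mE := mpre mB; set E := \bigcap_(i in _) _ in mE *.
have PE : (Pr E = (fine (Pr E))%:E)%E by rewrite fineK// fin_num_measure.
have e0 : 0 <= fine (Pr E) by rewrite fine_ge0.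
have kJ' : k \notin J by apply/negP => /kJ; rewrite ltnn.
(* On a rectangle the induction hypothesis is used twice: with [k] added to [J] it splits off [x k],
   and with [k] alone it puts [x k] and [P k] together again. *)
have key (A' : set T) (C : set S) : measurable A' -> measurable C ->
    Pr (x k @^-1` A' `&` P k @^-1` C `&` E) =
    (Pr E * Pr (x k @^-1` A' `&` P k @^-1` C))%E.
  move=> mA' mC; rewrite -setIA.
  have kS i : i \in (k |` J)%fset -> (k <= i)%N.
    by rewrite !inE => /orP[/eqP ->//|/kJ /ltnW].
  pose B1 i := if i == k then C else B i.
  have Jk i : i \in J -> (i == k) = false by move=> iJ; apply: contraNF kJ' => /eqP <-.
  have mB1 i : i \in (k |` J)%fset -> measurable (B1 i).
    by rewrite !inE /B1; case: eqP => //= _; exact: mB.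
  have := IH A' _ _ mA' kS mB1.
  have -> : \bigcap_(i in [set` (k |` J)%fset]) (P i @^-1` B1 i) = P k @^-1` C `&` E.
    apply/seteqP; split=> [w h'|w [PC PB] i /=].
      split; first by have := h' k; rewrite /= !inE /B1 eqxx; exact.
      move=> i /= iJ; have := h' i; rewrite /= !inE /B1 iJ orbT Jk//; exact.
    by rewrite !inE /B1; case: eqP => [->//|_ /= iJ]; exact: PB.
  move=> ->; rewrite independent_cons//.
  have := IH A' [fset k]%fset (fun=> C) mA' _ _.
  rewrite bigcap_fset1 => -> //; last by move=> i; rewrite inE => /eqP ->.
  by rewrite [RHS]muleC muleA.
(* Agreement on rectangles extends to all events of the pair [(x k, P k)], and [x k.+1] is a
   measurable function of that pair. *)
have := @pair_law_unique _ _ T S R _ _ (mrestr Pr mE)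
  (mscale (NngNum e0) Pr) (x k) (P k) (measurable_recursion k).
have -> : x k.+1 @^-1` A = (fun w => (x k w, P k w)) @^-1` ((fun z : T * S => h z.1 z.2) @^-1` A).
  by apply/seteqP; split=> w /=; rewrite x_S.
move=> h1; apply: (etrans (h1 _ _ _ _ _)) => //.
- by move=> A' C mA' mC; rewrite /= /mrestr /mscale /= -PE key.
- by rewrite /= /mrestr setTI (le_lt_trans (probability_le1 _ mE))// ltry.
- by rewrite -[X in measurable X]setTI; exact: mh.
- by rewrite /= /mscale /= -PE muleC.
Qed.

(** Independence makes the joint law of the state and the next matrix a product, and Tonelli then
    integrates the matrix with the state frozen. *)
Lemma recursion_integral k (phi : T * S -> \bar R) :
  measurable_fun setT phi -> (forall z, 0 <= phi z)%E ->
  (\int[Pr]_w phi (x k w, P k w) =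
   \int[Pr]_w \int[distribution Pr (P k)]_s phi (x k w, s))%E.
Proof.
move=> mphi phi0; have mx := measurable_recursion k.
pose X : {RV Pr >-> T} := HB.pack (x k) (isMeasurableFun.Build _ _ _ _ _ mx).
have mXP : measurable_fun setT (fun w => (x k w, P k w)) by exact: measurable_fun_pair.
transitivity (\int[pushforward Pr (fun w => (x k w, P k w))]_z phi z)%E.
  by rewrite ge0_integral_pushforward.
transitivity (\int[(distribution Pr X \x distribution Pr (P k))%E]_z phi z)%E.
  apply: eq_measure_integral => Z mZ _; apply/esym.
  apply: product_measure_unique => // A B mA mB.
  rewrite /distribution /pushforward /=.
  have := recursion_independent (k := k) (J := [fset k]%fset) (B := fun=> B) mA.
  rewrite bigcap_fset1; apply => // i; rewrite inE => /eqP ->//.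
rewrite fubini_tonelli1//.
rewrite ge0_integral_pushforward//.
- exact: measurable_fun_fubini_tonelli_F.
- by move=> y _; apply: integral_ge0.
Qed.

End recursion_independence.

Lemma tau_gt0 (R : realType) d r : (0 < d)%N -> (0 < r)%N -> 0 < tau R d r.
Proof.
case: d r => [//|d] [//|r] _ _.
by rewrite /tau !natr1 divr_gt0 ?mulr_gt0 ?sqrtr_gt0 ?divr_gt0 ?Gamma_half_gt0.
Qed.

(** * Descent *)

Section descent.
Context {R : realType} {d r : nat}.
Implicit Types (F : 'cV[R]_d -> R) (X : 'M[R]_(d, r)).

Lemma enorm_le_norm (x : 'cV[R]_d) : enorm x <= d%:R * `|x|.
Proof.
have x0 : 0 <= d%:R * `|x| by rewrite mulr_ge0.
rewrite -(@ler_pXn2r _ 2) ?nnegrE ?enorm_ge0// sqr_enorm dotpE.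
have xi i : x i ord0 * x i ord0 <= `|x| ^+ 2.
  rewrite -expr2 -real_normK ?num_real// ler_pXn2r ?nnegrE//.
  rewrite [leRHS]/Num.Def.normr/= mx_normrE.
  exact: (@le_bigmax _ _ _ 0 (fun ij => `|x ij.1 ij.2|) (i, ord0)).
apply: (le_trans (ler_sum _ (fun i _ => xi i))).
rewrite sumr_const card_ord exprMn -[leLHS]mulr_natl ler_wpM2r ?sqr_ge0//.
by rewrite -natrX ler_nat; case: (d) => // n; rewrite expnS expn1 leq_pmulr.
Qed.

Lemma norm_entry_le_enorm (x : 'cV[R]_d) i : `|x i ord0| <= enorm x.
Proof.
rewrite -(@ler_pXn2r _ 2) ?nnegrE ?enorm_ge0// sqr_enorm dotpE real_normK ?num_real//.
by rewrite (bigD1 i)//= -expr2 lerDl sumr_ge0// => j _; rewrite -expr2 sqr_ge0.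
Qed.

(** This is where smoothness provides the measurability of the gradient along the iterates; the
    factor [d] passes from the Euclidean norm to the maximum norm that defines the topology. *)
Lemma gradient_entry_continuous F L i : 0 < L -> lsmooth F L ->
  continuous (fun x => gradient F x i ord0).
Proof.
move=> L0 FL x; apply/(@cvgrPdist_le _ _ _ (nbhs x)) => e e0.
(* Taking [d + 1] for [d] keeps the divisor positive in every dimension. *)
have K0 : 0 < L * (d%:R + 1) by rewrite mulr_gt0// ltr_wpDl.
near=> y.
have -> : gradient F x i ord0 - gradient F y i ord0 = (gradient F x - gradient F y) i ord0.
  by rewrite !mxE.
apply: (le_trans (norm_entry_le_enorm _ _)); apply: (le_trans (FL x y)).
have xy : `|x - y| <= e / (L * (d%:R + 1)).
  by near: y; apply: cvgr_dist_le; [exact: cvg_id|rewrite divr_gt0].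
apply: (@le_trans _ _ (L * (d%:R * `|x - y|))).
  by rewrite ler_wpM2l ?enorm_le_norm// ltW.
rewrite mulrA (@le_trans _ _ (L * (d%:R + 1) * `|x - y|))//.
  by rewrite ler_wpM2r// ler_wpM2l ?ltW// ltrDl.
by rewrite mulrC -ler_pdivlMr.
Unshelve. all: by end_near.
Qed.

(** The inverse of 0 is 0, which absorbs the case distinction of the definition and gives a formula
    whose measurability is visible. *)
Lemma rsngd_dirE X (g : 'cV[R]_d) :
  rsngd_dir X g = (enorm (X^T *m g))^-1 *: (X *m X^T *m g).
Proof.
rewrite /rsngd_dir; case: ifPn => // /eqP Xg0.
by rewrite -mulmxA Xg0 mulmx0 scaler0.
Qed.

Lemma mx_measurable_rsngd_dir {dT} {T : measurableType dT}
    (f : T -> 'M[R]_(d, r)) (g : T -> 'cV[R]_d) :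
  mx_measurable f -> mx_measurable g -> mx_measurable (fun t => rsngd_dir (f t) (g t)).
Proof.
move=> mf mg.
have -> : (fun t => rsngd_dir (f t) (g t)) =
    (fun t => (enorm ((f t)^T *m g t))^-1 *: (f t *m (f t)^T *m g t)).
  by apply/funext => t; exact: rsngd_dirE.
apply: mx_measurable_scale.
  apply: measurable_inv_ge0; last by move=> t; exact: enorm_ge0.
  by apply: measurable_enorm; apply: mx_measurable_mul => //; exact: mx_measurable_tr.
apply: mx_measurable_mul => //; apply: mx_measurable_mul => //; exact: mx_measurable_tr.
Qed.

Lemma dotp_rsngd_dirl X (g : 'cV[R]_d) : dotp g (rsngd_dir X g) = enorm (X^T *m g).
Proof.
rewrite rsngd_dirE dotpZr.
have -> : dotp g (X *m X^T *m g) = enorm (X^T *m g) ^+ 2.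
  by rewrite sqr_enorm /dotp trmx_mul trmxK !mulmxA.
have [->|n0] := eqVneq (enorm (X^T *m g)) 0; first by rewrite expr0n mulr0.
by rewrite expr2 mulKf.
Qed.

Lemma rsngd_descent F (A : 'M[R]_d) s X (x : 'cV[R]_d) :
  (forall x y : 'cV[R]_d, F y - F x - dotp (gradient F x) (y - x)
     <= 2^-1 * dotp (y - x) (A *m (y - x))) ->
  F (x - s *: rsngd_dir X (gradient F x)) + s * enorm (X^T *m gradient F x) <=
  F x + s ^+ 2 / 2 * dotp (rsngd_dir X (gradient F x)) (A *m rsngd_dir X (gradient F x)).
Proof.
move=> FA; set G := rsngd_dir _ _; have := FA x (x - s *: G).
have -> : x - s *: G - x = - s *: G by rewrite addrAC subrr add0r scaleNr.
rewrite dotpZr /G dotp_rsngd_dirl -/G -scalemxAr dotpZl dotpZr.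
lra.
Qed.

End descent.

(** * Descent in expectation and telescoping *)

Section expected_descent.
Context {R : realType} {disp : measure_display} {Omega : measurableType disp}.
Variables (Pr : probability Omega R) (d r : nat).
Hypotheses (hd : (1 < d)%N) (hr : (0 < r)%N) (hrd : (r <= d)%N).
Variables (F : 'cV[R]_d -> R) (L : R) (A : 'M[R]_d) (s : R) (x0 : 'cV[R]_d).
Hypotheses (Fdiff : forall x, differentiable F x) (Fbd : has_lbound (range F)).
Hypotheses (L0 : 0 < L) (FL : lsmooth F L) (A0 : A != 0) (Apsd : psd A).
Hypothesis FA : forall x y : 'cV[R]_d,
  F y - F x - dotp (gradient F x) (y - x) <= 2^-1 * dotp (y - x) (A *m (y - x)).
Hypothesis s0 : 0 < s.
Variable P : nat -> {RV Pr >-> mxBorel R d r}.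
Hypothesis Pindep : mutually_independent P.
Hypothesis Phaar : forall k, haar_matrix hrd (P k).

Local Notation x k w := (rsngd F s x0 (fun j => P j w) k).
Local Notation gap y := (F y - inf (range F)).

(** Subtracting the infimum makes the integrand nonnegative, so its expectation exists in the
    extended reals and can be added to the others freely. *)
Let gap_ge0 y : 0 <= gap y.
Proof. by rewrite subr_ge0; apply: ge_inf => //; exists y. Qed.

Let mgrad {dT} {T : measurableType dT} (f : T -> 'cV[R]_d) :
  mx_measurable f -> mx_measurable (fun t => gradient F (f t)).
Proof.
move=> mf i j; rewrite ord1.
have mg : measurable_fun setT (fun y : mxBorel R d 1 => gradient F y i ord0).
  by apply: continuous_mxBorel; exact: gradient_entry_continuous L0 FL.
have mf' : measurable_fun setT (f : T -> mxBorel R d 1) by exact/mx_measurable_fun.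
exact: (measurableT_comp mg mf').
Qed.

Let mF {dT} {T : measurableType dT} (f : T -> 'cV[R]_d) :
  mx_measurable f -> measurable_fun setT (fun t => F (f t)).
Proof.
move=> mf; have mF' : measurable_fun setT (F : mxBorel R d 1 -> R).
  by apply: continuous_mxBorel => y; exact/differentiable_continuous.
have mf' : measurable_fun setT (f : T -> mxBorel R d 1) by exact/mx_measurable_fun.
exact: (measurableT_comp mF' mf').
Qed.

Let mfst : mx_measurable (fun z : mxBorel R d 1 * mxBorel R d r => z.1 : 'cV[R]_d).
Proof. by apply/mx_measurable_fun; exact: measurable_fst. Qed.

Let msnd : mx_measurable (fun z : mxBorel R d 1 * mxBorel R d r => z.2 : 'M[R]_(d, r)).
Proof. by apply/mx_measurable_fun; exact: measurable_snd. Qed.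

Let h (y : mxBorel R d 1) (X : mxBorel R d r) : mxBorel R d 1 :=
  (y : 'cV[R]_d) - s *: rsngd_dir X (gradient F y).

Let mstep : measurable_fun setT (fun z : mxBorel R d 1 * mxBorel R d r => h z.1 z.2).
Proof.
apply/mx_measurable_fun; apply: mx_measurable_sub => //.
apply: mx_measurable_scale; first exact: measurable_cst.
by apply: mx_measurable_rsngd_dir => //; exact: mgrad.
Qed.

Let mx_x k : measurable_fun setT (fun w => x k w : mxBorel R d 1).
Proof.
exact: (@measurable_recursion _ _ _ _ _ _ _ Pr P
  h (x0 : mxBorel R d 1)
  (fun k w => x k w : mxBorel R d 1) mstep (fun=> erefl) (fun _ _ => erefl) k).
Qed.

Let integral_x k (phi : mxBorel R d 1 * mxBorel R d r -> \bar R) :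
  measurable_fun setT phi -> (forall z, 0 <= phi z)%E ->
  (\int[Pr]_w phi (x k w, P k w) =
   \int[Pr]_w \int[distribution Pr (P k)]_X phi (x k w, X))%E.
Proof.
exact: (@recursion_integral _ _ _ _ _ _ _ Pr P Pindep
  h (x0 : mxBorel R d 1)
  (fun k w => x k w : mxBorel R d 1) mstep (fun=> erefl) (fun _ _ => erefl) k).
Qed.

Let integral_cstP (c : R) : (\int[Pr]_w c%:E = c%:E)%E.
Proof.
rewrite integral_cst// -[RHS]mule1; congr (_ * _)%E.
exact: probability_setT.
Qed.

Let law_enorm k g :
  (\int[distribution Pr (P k)]_X (enorm ((X : 'M[R]_(d, r))^T *m g))%:E =
   (tau R d r * enorm g)%:E)%E.
Proof.
have lawP := haar_matrix_law (Phaar k).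
exact: (haar_enorm lawP hr hrd g).
Qed.

Let law_quadratic k g :
  (\int[distribution Pr (P k)]_X
     (dotp (rsngd_dir (X : 'M[R]_(d, r)) g) (A *m rsngd_dir (X : 'M[R]_(d, r)) g))%:E <=
   (ell r A * opnorm A)%:E)%E.
Proof.
have lawP := haar_matrix_law (Phaar k).
exact: (haar_quadratic lawP hr hrd g hd A0 Apsd).
Qed.

Lemma expected_enorm_projected_gradient k :
  (\int[Pr]_w (enorm ((P k w)^T *m gradient F (x k w)))%:E =
   (tau R d r)%:E * \int[Pr]_w (enorm (gradient F (x k w)))%:E)%E.
Proof.
rewrite (integral_x k (phi := fun z => (enorm ((z.2 : 'M[R]_(d, r))^T *m gradient F z.1))%:E)).
- transitivity (\int[Pr]_w ((tau R d r)%:E * (enorm (gradient F (x k w)))%:E))%E.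
    apply: eq_integral => w _; rewrite -EFinM.
    exact: (law_enorm k (gradient F (x k w))).
  have t0 : 0 <= tau R d r := ltW (tau_gt0 R (ltnW hd) hr).
  rewrite ge0_integralZl_EFin//.
  + by move=> w _; rewrite lee_fin enorm_ge0.
  + apply/measurable_EFinP; apply: measurable_enorm; apply: mgrad.
    exact/mx_measurable_fun.
- apply/measurable_EFinP; apply: measurable_enorm; apply: mx_measurable_mul.
    exact: mx_measurable_tr.
  exact: mgrad.
- by move=> z; rewrite lee_fin enorm_ge0.
Qed.

Lemma expected_quadratic_le k :
  (\int[Pr]_w (dotp (rsngd_dir (P k w) (gradient F (x k w)))
      (A *m rsngd_dir (P k w) (gradient F (x k w))))%:E <= (ell r A * opnorm A)%:E)%E.
Proof.
have [_ Age0] := Apsd.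
have mq : measurable_fun setT (fun z : mxBorel R d 1 * mxBorel R d r =>
   (dotp (rsngd_dir z.2 (gradient F z.1)) (A *m rsngd_dir z.2 (gradient F z.1)))%:E).
  have mdir := mx_measurable_rsngd_dir msnd (mgrad mfst).
  apply/measurable_EFinP; apply: measurable_dotp; first exact: mdir.
  by apply: mx_measurable_mul; [exact: mx_measurable_cst|exact: mdir].
have q0 (z : mxBorel R d 1 * mxBorel R d r) : (0 <= (dotp (rsngd_dir z.2 (gradient F z.1))
    (A *m rsngd_dir z.2 (gradient F z.1)))%:E)%E by rewrite lee_fin Age0.
rewrite (integral_x k mq q0).
rewrite -(integral_cstP (ell r A * opnorm A)).
apply: ge0_le_integral => //.
- by move=> w _; apply: integral_ge0 => X _; rewrite lee_fin Age0.
- exact: (measurableT_comp (measurable_fun_fubini_tonelli_F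
    (m2 := distribution Pr (P k)) _ mq q0) (mx_x k)).
- by move=> w _; exact: (law_quadratic k (gradient F (x k w))).
Qed.

(** Both sides add terms instead of subtracting them, since a difference of possibly infinite
    expectations would carry no information. *)
Lemma expected_descent k :
  (\int[Pr]_w (gap (x k.+1 w))%:E +
     (s * tau R d r)%:E * \int[Pr]_w (enorm (gradient F (x k w)))%:E <=
   \int[Pr]_w (gap (x k w))%:E + (s ^+ 2 / 2 * (ell r A * opnorm A))%:E)%E.
Proof.
have [_ Age0] := Apsd.
have xM : mx_measurable (fun w => x k w) by exact/mx_measurable_fun.
have PM : mx_measurable (fun w => P k w : 'M[R]_(d, r)) by exact/mx_measurable_fun.
pose p w := enorm ((P k w)^T *m gradient F (x k w)).
pose q w := dotp (rsngd_dir (P k w) (gradient F (x k w)))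
  (A *m rsngd_dir (P k w) (gradient F (x k w))).
have mp : measurable_fun setT (fun w => (p w)%:E).
  apply/measurable_EFinP; apply: measurable_enorm; apply: mx_measurable_mul; last exact: mgrad.
  exact: mx_measurable_tr.
have mq : measurable_fun setT (fun w => (q w)%:E).
  have mdir := mx_measurable_rsngd_dir PM (mgrad xM).
  apply/measurable_EFinP; apply: measurable_dotp; first exact: mdir.
  by apply: mx_measurable_mul; [exact: mx_measurable_cst|exact: mdir].
have p0 w : (0 <= (p w)%:E)%E by rewrite lee_fin enorm_ge0.
have q0 w : (0 <= (q w)%:E)%E by rewrite lee_fin Age0.
have mgap j : measurable_fun setT (fun w => (gap (x j w))%:E).
  apply/measurable_EFinP; apply: measurable_funB; last exact: measurable_cst.
  by apply: mF; exact/mx_measurable_fun.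
have gap0 j w : (0 <= (gap (x j w))%:E)%E by rewrite lee_fin gap_ge0.
have c0 : 0 <= s ^+ 2 / 2 by rewrite divr_ge0 ?sqr_ge0.
have mZ c (f : Omega -> \bar R) : measurable_fun setT f ->
    measurable_fun setT (fun w => c%:E * f w)%E.
  by move=> mf; apply: emeasurable_funM => //; exact: measurable_cst.
rewrite EFinM -muleA -expected_enorm_projected_gradient.
apply: (@le_trans _ _ (\int[Pr]_w ((gap (x k w))%:E + (s ^+ 2 / 2)%:E * (q w)%:E))%E).
  rewrite -ge0_integralZl_EFin//; [|by move=> w _; rewrite lee_fin enorm_ge0|exact: ltW].
  rewrite -ge0_integralD//; [|by move=> w _; rewrite mule_ge0 ?lee_fin ?(ltW s0) ?enorm_ge0|exact: mZ].
  apply: ge0_le_integral => //.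
  - by move=> w _; rewrite adde_ge0// mule_ge0 ?lee_fin ?(ltW s0) ?enorm_ge0.
  - by apply: emeasurable_funD => //; exact: mZ.
  - by apply: emeasurable_funD => //; exact: mZ.
  move=> w _; rewrite -!EFinM -!EFinD lee_fin /=.
  by have := rsngd_descent s (P k w) (x k w) FA; rewrite -/(p w) -/(q w); lra.
rewrite ge0_integralD//; [|by move=> w _; rewrite mule_ge0|exact: mZ].
rewrite leeD2l// ge0_integralZl_EFin// [leRHS]EFinM lee_wpmul2l ?lee_fin//.
exact: expected_quadratic_le.
Qed.

Lemma sum_expected_enorm_gradient n :
  ((s * tau R d r)%:E * \sum_(0 <= k < n) \int[Pr]_w (enorm (gradient F (x k w)))%:E <=
   (gap x0 + n%:R * (s ^+ 2 / 2 * (ell r A * opnorm A)))%:E)%E.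
Proof.
have st0 : 0 <= s * tau R d r by rewrite mulr_ge0 ?(ltW s0)// (ltW (tau_gt0 R (ltnW hd) hr)).
have G0 k : (0 <= \int[Pr]_w (enorm (gradient F (x k w)))%:E)%E.
  by apply: integral_ge0 => w _; rewrite lee_fin enorm_ge0.
set C := s ^+ 2 / 2 * _.
(* The gap at step [n] is kept for the induction, where the next descent inequality consumes it, and
   is dropped only at the end. *)
suff : (\int[Pr]_w (gap (x n w))%:E + (s * tau R d r)%:E *
     \sum_(0 <= k < n) \int[Pr]_w (enorm (gradient F (x k w)))%:E <=
   (gap x0 + n%:R * C)%:E)%E.
  apply: le_trans; rewrite leeDr//.
  by apply: integral_ge0 => w _; rewrite lee_fin gap_ge0.
elim: n => [|n IH].
  rewrite big_geq// mule0 adde0 mul0r addr0 /=.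
  by rewrite integral_cstP.
rewrite big_nat_recr//= ge0_muleDr ?sume_ge0//.
have -> : gap x0 + n.+1%:R * C = gap x0 + n%:R * C + C.
  by rewrite -(natr1 n) mulrDl mul1r addrA.
rewrite addeCA [leRHS]EFinD; apply: (le_trans (leeD2l _ (expected_descent n))).
by rewrite addeA leeD2r// addeC.
Qed.

End expected_descent.

Theorem theoremD1 (R : realType)
    (disp : measure_display) (Omega : measurableType disp)
    (Pr : probability Omega R)
    (d r : nat) (hd : (2 <= d)%N) (hr : (1 <= r)%N) (hrd : (r <= d)%N)
    (F : 'cV[R]_d -> R)
    (hFdiff : forall x, differentiable F x)
    (hFbd : has_lbound (range F))
    (L : R) (hL : 0 < L) (hFL : lsmooth F L)
    (LL : 'M[R]_d) (hLL0 : LL != 0) (hLLpsd : psd LL)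
    (hFLL : forall x y : 'cV[R]_d,
       F y - F x - dotp (gradient F x) (y - x)
         <= 2^-1 * dotp (y - x) (LL *m (y - x)))
    (T : nat) (hT : (1 <= T)%N)
    (eta u : R) (heta : 0 < eta) (hu0 : 0 < u) (hu1 : u < 1)
    (x0 : 'cV[R]_d)
    (P : nat -> {RV Pr >-> mxBorel R d r})
    (hPindep : mutually_independent P)
    (hPhaar : forall k, haar_matrix hrd (P k)) :
  let x (k : nat) (w : Omega) : 'cV[R]_d :=
    rsngd F (eta * T%:R `^ (- u)) x0 (fun j => P j w) k in
  let Delta0 : R := F x0 - inf (range F) in
  ((T%:R^-1)%:E * \sum_(0 <= k < T) 'E_Pr[fun w => enorm (gradient F (x k w))]
    <= (Delta0 / (eta * tau R d r * T%:R `^ (1 - u))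
        + eta * ell r LL * opnorm LL / (2 * tau R d r * T%:R `^ u))%:E)%E.
Proof.
cbv zeta; set Delta0 := F x0 - _.
have T0 : 0 < T%:R :> R by rewrite ltr0n.
pose s := eta * T%:R `^ (- u).
have Tu : 0 < T%:R `^ u :> R by exact: powR_gt0.
have s0 : 0 < s by rewrite mulr_gt0// powR_gt0.
have t0 := tau_gt0 R (ltnW hd) hr.
under eq_bigr do rewrite unlock.
have := sum_expected_enorm_gradient hd hr x0 hFdiff hFbd hL hFL hLL0 hLLpsd hFLL s0 hPindep hPhaar T.
set SE := (\sum_(0 <= k < T) _)%E => h.
(* Division by [s tau T] with [s = eta T^(-u)]: [s T = eta T^(1-u)] produces the first denominator,
   and [s^2 / (2 s tau) = eta / (2 tau T^u)] the second coefficient. *)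
have -> : Delta0 / (eta * tau R d r * T%:R `^ (1 - u))
    + eta * ell r LL * opnorm LL / (2 * tau R d r * T%:R `^ u) =
    T%:R^-1 * ((s * tau R d r)^-1 *
      (Delta0 + T%:R * (s ^+ 2 / 2 * (ell r LL * opnorm LL)))).
  rewrite /s powRN powRB ?(gt_eqF T0) ?implybT// powRr1 ?(ltW T0)//.
  by field; rewrite !lt0r_neq0.
rewrite [leRHS]EFinM lee_wpmul2l ?lee_fin ?invr_ge0//.
by rewrite EFinM lee_pdivlMl// mulr_gt0.
Qed.
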